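(* Let $k$ be a field of characteristic zero and let $\mathscr{U}\subseteq\mathscr{G}$ be a full, replete and widely closed subcategory such that the tensor unit of $\mathsf{D}(\mathscr{U})$ is compact. For $G\in\mathscr{U}$ put $\mathfrak{p}_G=\{X\in\mathsf{D}(\mathscr{U})^c\mid X(G)\simeq 0\}$. Given two groups $G,H\in\mathscr{U}$, there is an inclusion $\mathfrak{p}_H\subseteq\mathfrak{p}_G$ if and only if $G$ is isomorphic to $H$. In particular, the map $\mathfrak{p}_{-}\colon\pi_0\mathscr{U}\to\mathrm{Spc}(\mathsf{D}(\mathscr{U})^c)$, $G\mapsto\mathfrak{p}_G$, is injective.
   Context: $\mathscr{G}$ is the category of finite groups with morphisms the conjugacy classes of surjective group homomorphisms. A full subcategory $\mathscr{U}\subseteq\mathscr{G}$ closed under isomorphism (replete) is widely closed if whenever $G\twoheadleftarrow H\twoheadrightarrow K$ are surjective homomorphisms with $G,H,K\in\mathscr{U}$, the image of $H\to G\times K$ lies in $\mathscr{U}$. $\pi_0\mathscr{U}$ is the set of isomorphism classes of objects. $\mathsf{D}(\mathscr{U})$ is the derived category of $\mathrm{Fun}(\mathscr{U}^{\mathrm{op}},\mathrm{Mod}_k)$, with the pointwise tensor product over $k$ (unit: the constant functor $k$), and $\mathsf{D}(\mathscr{U})^c$ is its full subcategory of compact objects, an essentially small tensor-triangulated category under these hypotheses. The Balmer spectrum $\mathrm{Spc}(\mathscr{K})$ is the space of prime thick ideals of $\mathscr{K}$; each $\mathfrak{p}_G$ is such a prime. *)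

(* Defs.v *)
From HB Require Import structures.
From mathcomp Require Import all_boot all_order all_algebra all_fingroup.

Set Implicit Arguments.
Unset Strict Implicit.
Unset Printing Implicit Defensive.

Import GRing.Theory.
Local Open Scope ring_scope.

(** * The category of finite groups and conjugacy classes of surjections *)

Record epi (G H : finGroupType) := Epi {
  epi_fun :> G -> H;
  epiM : {morph epi_fun : x y / (x * y)%g};
  epi_surj : forall y, exists x, epi_fun x = y }.

Definition epi_conj (G H : finGroupType) (f g : epi G H) : Prop :=
  exists h : H, forall x, g x = (f x ^ h)%g.

Lemma epi_idM (G : finGroupType) : {morph (@id G) : x y / (x * y)%g}.
Proof. by []. Qed.

Lemma epi_id_surj (G : finGroupType) (y : G) : exists x, id x = y.
Proof. by exists y. Qed.

Definition epi_id (G : finGroupType) : epi G G :=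
  Epi (@epi_idM G) (@epi_id_surj G).

Section EpiComp.
Variables (G H K : finGroupType) (g : epi H K) (f : epi G H).

Lemma epi_compM : {morph g \o f : x y / (x * y)%g}.
Proof. by move=> x y /=; rewrite !epiM. Qed.

Lemma epi_comp_surj z : exists x, (g \o f) x = z.
Proof.
have [y <-] := epi_surj g z; have [x <-] := epi_surj f y.
by exists x.
Qed.

Definition epi_comp : epi G K := Epi epi_compM epi_comp_surj.
End EpiComp.

Section PairImage.
Variables (G H K : finGroupType) (f : epi H G) (g : epi H K).

Lemma epi_pairM :
  {in [set: H] &, {morph (fun x => (f x, g x)) : x y / (x * y)%g}}.
Proof. by move=> x y _ _ /=; rewrite !epiM. Qed.

Definition epi_pair : {morphism [set: H] >-> G * K} := Morphism epi_pairM.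

Definition pair_image : {group G * K} := (epi_pair @* [set: H])%G.
End PairImage.

(** A full subcategory is given by its class of objects. *)

Definition replete (U : finGroupType -> Prop) : Prop :=
  forall G H : finGroupType, [set: G] \isog [set: H] -> U G -> U H.

Definition widely_closed (U : finGroupType -> Prop) : Prop :=
  forall (G H K : finGroupType) (f : epi H G) (g : epi H K),
    U G -> U H -> U K -> U (subg_of (pair_image f g)).

Record obj (U : finGroupType -> Prop) := Obj {
  obj_group :> finGroupType;
  objP : U obj_group }.

Definition obj_iso (U : finGroupType -> Prop) (G H : obj U) : Prop :=
  [set: G] \isog [set: H].

Definition pi0 (U : finGroupType -> Prop) : Type :=
  {C : obj U -> Prop | exists G, C = obj_iso G}.

Definition pi0_class (U : finGroupType -> Prop) (G : obj U) : pi0 U :=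
  exist _ (obj_iso G) (ex_intro _ G erefl).

(** * The abelian category Fun(U^op, Mod_k) *)

Section Functors.
Variables (k : fieldType) (U : finGroupType -> Prop).

(* A functor on U^op is a functor on groups and surjections that identifies
   conjugate surjections. *)
Record functor := Functor {
  fob :> obj U -> lmodType k;
  fmap : forall G H : obj U, epi G H -> {linear fob H -> fob G};
  fmap_conj : forall (G H : obj U) (f g : epi G H),
    epi_conj f g -> fmap f =1 fmap g;
  fmap_id : forall G : obj U, fmap (epi_id G) =1 id;
  fmap_comp : forall (G H K : obj U) (g : epi H K) (f : epi G H),
    @fmap G K (epi_comp g f) =1 fmap f \o fmap g }.

Record nat_trans (M N : functor) := NatTrans {
  nt_fun :> forall G : obj U, {linear M G -> N G};
  nt_nat : forall (G H : obj U) (f : epi G H) (x : M H),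
    nt_fun G (fmap M f x) = fmap N f (nt_fun H x) }.

Definition nt_id (M : functor) : nat_trans M M :=
  @NatTrans M M (fun G => idfun) (fun G H f x => erefl).

Section NtComp.
Variables (M N P : functor) (g : nat_trans N P) (f : nat_trans M N).

Lemma nt_comp_nat (G H : obj U) (e : epi G H) (x : M H) :
  (g G \o f G) (fmap M e x) = fmap P e ((g H \o f H) x).
Proof. by rewrite /= !nt_nat. Qed.

Definition nt_comp : nat_trans M P :=
  @NatTrans M P (fun G => g G \o f G) nt_comp_nat.
End NtComp.

Section NtZero.
Variables M N : functor.

Lemma nt_zero_nat (G H : obj U) (e : epi G H) (x : M H) :
  (\0 : {linear M G -> N G}) (fmap M e x) =
  fmap N e ((\0 : {linear M H -> N H}) x).
Proof. by rewrite /= linear0. Qed.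

Definition nt_zero : nat_trans M N := @NatTrans M N (fun G => \0) nt_zero_nat.
End NtZero.

Definition const_functor (V : lmodType k) : functor :=
  @Functor (fun=> V) (fun G H f => idfun) (fun G H f g _ x => erefl)
    (fun G x => erefl) (fun G H K g f x => erefl).

(** * Unbounded chain complexes of functors *)

(* Differentials are given between any two degrees and vanish unless they
   lower the degree by one, so that no transport between degrees is needed. *)
Record cx := Cx {
  cob :> int -> functor;
  cd : forall n m, nat_trans (cob n) (cob m);
  cd_shape : forall (n m : int) (G : obj U) (x : cob n G),
    n != m + 1 -> cd n m G x = 0;
  cd2 : forall (n m p : int) (G : obj U) (x : cob n G),
    cd m p G (cd n m G x) = 0 }.

Definition cycle (X : cx) (n : int) (G : obj U) (x : X n G) : Prop :=
  cd X n (n - 1) G x = 0.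

Definition boundary (X : cx) (n : int) (G : obj U) (x : X n G) : Prop :=
  exists y : X (n + 1) G, cd X (n + 1) n G y = x.

Record chmap (X Y : cx) := Chmap {
  ch_fun :> forall n, nat_trans (X n) (Y n);
  ch_comm : forall (n m : int) (G : obj U) (x : X n G),
    ch_fun m G (cd X n m G x) = cd Y n m G (ch_fun n G x) }.

Definition ch_id (X : cx) : chmap X X :=
  @Chmap X X (fun n => nt_id (X n)) (fun n m G x => erefl).

Section ChComp.
Variables (X Y Z : cx) (g : chmap Y Z) (f : chmap X Y).

Lemma ch_comp_comm (n m : int) (G : obj U) (x : X n G) :
  nt_comp (g m) (f m) G (cd X n m G x) =
  cd Z n m G (nt_comp (g n) (f n) G x).
Proof. by rewrite /= !ch_comm. Qed.

Definition ch_comp : chmap X Z :=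
  @Chmap X Z (fun n => nt_comp (g n) (f n)) ch_comp_comm.
End ChComp.

Definition homotopic (X Y : cx) (f g : chmap X Y) : Prop :=
  exists h : forall n m, nat_trans (X n) (Y m),
  forall (n : int) (G : obj U) (x : X n G),
    f n G x - g n G x =
      cd Y (n + 1) n G (h n (n + 1) G x) +
      h (n - 1) n G (cd X n (n - 1) G x).

(* Injectivity and surjectivity of H_n(X(G)) -> H_n(Y(G)) for all n and G. *)
Definition quasi_iso (X Y : cx) (f : chmap X Y) : Prop :=
  forall (n : int) (G : obj U),
    (forall x : X n G, cycle x -> boundary (f n G x) -> boundary x) /\
    (forall y : Y n G, cycle y ->
       exists2 x : X n G, cycle x & boundary (f n G x - y)).

Lemma quasi_iso_id (X : cx) : quasi_iso (ch_id X).
Proof.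
move=> n G; split=> // y cy; exists y => //.
by exists 0; rewrite linear0 /= subrr.
Qed.

Lemma quasi_iso_comp (X Y Z : cx) (g : chmap Y Z) (f : chmap X Y) :
  quasi_iso g -> quasi_iso f -> quasi_iso (ch_comp g f).
Proof.
move=> qg qf n G; have [ig sg] := qg n G; have [jf sf] := qf n G.
split=> [x cx0 bx|z cz].
  apply: jf => //; apply: ig => //.
  by rewrite /cycle -ch_comm cx0 linear0.
have [y cy [w dw]] := sg z cz; have [x cx0 [v dv]] := sf y cy.
exists x => //; exists (g (n + 1) G v + w).
by rewrite linearD dw -ch_comm dv linearB /= addrA subrK.
Qed.

(* The complex M concentrated in degree 0. *)
Section Stalk.
Variable M : functor.

Definition stalk_ob (n : int) : functor :=
  if n == 0 then M else const_functor 'rV[k]_0.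

Lemma stalk_shape (n m : int) (G : obj U) (x : stalk_ob n G) :
  n != m + 1 -> nt_zero (stalk_ob n) (stalk_ob m) G x = 0.
Proof. by []. Qed.

Lemma stalk_d2 (n m p : int) (G : obj U) (x : stalk_ob n G) :
  nt_zero (stalk_ob m) (stalk_ob p) G
    (nt_zero (stalk_ob n) (stalk_ob m) G x) = 0.
Proof. by []. Qed.

Definition stalk : cx := Cx stalk_shape stalk_d2.
End Stalk.

Definition unit_cx : cx := stalk (const_functor k^o).

Definition zero_cx : cx := stalk (const_functor 'rV[k]_0).

(** * The derived category: morphisms are fractions of chain maps *)

Record roof (X Y : cx) := Roof {
  apex : cx;
  den : chmap apex X;
  num : chmap apex Y;
  den_qi : quasi_iso den }.

(* Equality of morphisms of the derived category. *)
Definition roof_eq (X Y : cx) (r s : roof X Y) : Prop :=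
  exists (W : cx) (u : chmap W (apex r)) (v : chmap W (apex s)),
    [/\ quasi_iso u,
        homotopic (ch_comp (den r) u) (ch_comp (den s) v) &
        homotopic (ch_comp (num r) u) (ch_comp (num s) v)].

Definition roof_id (X : cx) : roof X X := Roof (ch_id X) (@quasi_iso_id X).

(* t is the composite of r followed by s. *)
Definition roof_comp (X Y Z : cx) (r : roof X Y) (s : roof Y Z)
    (t : roof X Z) : Prop :=
  exists (W : cx) (u : chmap W (apex r)) (v : chmap W (apex s))
         (qu : quasi_iso u),
    homotopic (ch_comp (num r) u) (ch_comp (den s) v) /\
    roof_eq (Roof (ch_comp (num s) v) (quasi_iso_comp (den_qi r) qu)) t.

Definition D_iso (X Y : cx) : Prop :=
  exists (r : roof X Y) (s : roof Y X),
    roof_comp r s (roof_id X) /\ roof_comp s r (roof_id Y).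

(* S is the direct sum of the Y i, pointwise in each degree; as direct sums
   of k-modules are exact, this is the coproduct both of complexes and in the
   derived category. *)
Definition is_coproduct (I : choiceType) (Y : I -> cx) (S : cx)
    (inj : forall i, chmap (Y i) S) : Prop :=
  forall (n : int) (G : obj U),
    (forall y : S n G, exists (s : seq I) (c : forall i, Y i n G),
       uniq s /\ y = \sum_(i <- s) inj i n G (c i)) /\
    (forall (s : seq I) (c : forall i, Y i n G), uniq s ->
       \sum_(i <- s) inj i n G (c i) = 0 -> forall i, i \in s -> c i = 0).

(* r = \sum_(i <- s) inj i \o phi i in Hom_D(X, S): fractions are added over
   a common denominator t. *)
Definition roof_sum (I : choiceType) (Y : I -> cx) (S : cx)
    (inj : forall i, chmap (Y i) S) (X : cx) (s : seq I)
    (phi : forall i, roof X (Y i)) (r : roof X S) : Prop :=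
  exists (Z : cx) (t : chmap Z X) (qt : quasi_iso t)
         (a : forall i, chmap Z (Y i)) (b : chmap Z S),
    [/\ forall i, i \in s -> roof_eq (Roof (a i) qt) (phi i),
        forall n (G : obj U) (z : Z n G),
          b n G z = \sum_(i <- s) inj i n G (a i n G z) &
        roof_eq (Roof b qt) r].

(* The map (+)_i Hom_D(X, Y i) -> Hom_D(X, (+)_i Y i) is bijective.  An
   element of the source is a finite set s of indices together with the
   components phi i for i in s. *)
Definition compact (X : cx) : Prop :=
  forall (I : choiceType) (Y : I -> cx) (S : cx)
         (inj : forall i, chmap (Y i) S), is_coproduct inj ->
    (forall r : roof X S, exists (s : seq I) (phi : forall i, roof X (Y i)),
       uniq s /\ roof_sum inj s phi r) /\
    (forall (s : seq I) (phi psi : forall i, roof X (Y i)) (r : roof X S),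
       uniq s -> roof_sum inj s phi r -> roof_sum inj s psi r ->
       forall i, i \in s -> roof_eq (phi i) (psi i)).

Record cpt := Cpt { cpt_cx :> cx; cptP : compact cpt_cx }.

(** * Triangles, sums and tensor products *)

Definition short_exact (X Y Z : cx) (f : chmap X Y) (g : chmap Y Z) : Prop :=
  forall (n : int) (G : obj U),
    [/\ injective (f n G),
        forall y : Y n G, g n G y = 0 <-> (exists x, f n G x = y) &
        forall z : Z n G, exists y, g n G y = z].

(* A, B, C are the vertices of an exact triangle A -> B -> C -> A[1]: up to
   isomorphism these come from short exact sequences of complexes. *)
Definition exact_triangle (A B C : cx) : Prop :=
  exists (X Y Z : cx) (f : chmap X Y) (g : chmap Y Z),
    [/\ short_exact f g, D_iso A X, D_iso B Y & D_iso C Z].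

Definition is_biproduct (A B C : cx) : Prop :=
  exists inj : forall b : bool, chmap (if b then A else B) C,
    is_coproduct inj.

Definition bilin (V W T : lmodType k) (f : V -> W -> T) : Prop :=
  (forall v, linear (f v)) /\ (forall w, linear (f^~ w)).

(* Z is the pointwise tensor product over k of X and Y: the b p q exhibit
   Z_n(G) as the direct sum of the X_p(G) (x) Y_q(G) over p + q = n.  It is
   exact in each variable since k is a field, so it needs no deriving. *)
Record tensor_structure (X Y Z : cx)
    (b : forall p q n : int, p + q = n ->
         forall G : obj U, X p G -> Y q G -> Z n G) : Prop := {
  tensor_bilin : forall p q n (e : p + q = n) (G : obj U), bilin (b p q n e G);
  tensor_nat : forall p q n (e : p + q = n) (G H : obj U) (f : epi G H)
      (x : X p H) (y : Y q H),
    b p q n e G (fmap (X p) f x) (fmap (Y q) f y) =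
    fmap (Z n) f (b p q n e H x y);
  tensor_d : forall p q n (e : p + q = n) p' q' m
      (e1 : p' + q = m) (e2 : p + q' = m) (G : obj U) (x : X p G) (y : Y q G),
    n = m + 1 ->
    cd Z n m G (b p q n e G x y) =
      b p' q m e1 G (cd X p p' G x) y +
      ((-1 : k) ^ p) *: b p q' m e2 G x (cd Y q q' G y);
  tensor_univ : forall (n : int) (G : obj U) (T : lmodType k)
      (c : forall p q : int, p + q = n -> X p G -> Y q G -> T),
    (forall p q (e : p + q = n), bilin (c p q e)) ->
    exists h : {linear Z n G -> T},
      (forall p q (e : p + q = n) x y, h (b p q n e G x y) = c p q e x y) /\
      (forall h' : {linear Z n G -> T},
        (forall p q (e : p + q = n) x y, h' (b p q n e G x y) = c p q e x y) ->
        h' =1 h) }.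

Definition is_tensor (X Y Z : cx) : Prop :=
  exists b, @tensor_structure X Y Z b.

(** * The Balmer spectrum of the category of compact objects *)

Record thick_tensor_ideal (P : cpt -> Prop) : Prop := {
  ideal0 : forall X : cpt, D_iso X zero_cx -> P X;
  ideal_iso : forall X Y : cpt, D_iso X Y -> P X -> P Y;
  ideal_tri : forall A B C : cpt, exact_triangle A B C ->
    [/\ P A -> P B -> P C, P A -> P C -> P B & P B -> P C -> P A];
  ideal_summand : forall A B C : cpt, is_biproduct A B C -> P C -> P A /\ P B;
  ideal_tensor : forall X Y Z : cpt, is_tensor X Y Z -> P X -> P Z }.

Record prime_ideal (P : cpt -> Prop) : Prop := {
  prime_thick : thick_tensor_ideal P;
  prime_proper : exists X : cpt, ~ P X;
  prime_tensor : forall X Y Z : cpt, is_tensor X Y Z -> P Z -> P X \/ P Y }.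

Record Spc := SpcPoint {
  spc_ideal :> cpt -> Prop;
  spcP : prime_ideal spc_ideal }.

(* X(G) is zero in the derived category of k-modules, i.e., acyclic. *)
Definition acyclic_at (G : obj U) (X : cx) : Prop :=
  forall (n : int) (x : X n G), cycle x -> boundary x.

Definition pideal (G : obj U) (X : cpt) : Prop := acyclic_at G X.

End Functors.

Arguments pideal {k U} G X.

(* Main.v *)
From HB Require Import structures.
From mathcomp Require Import all_boot all_order all_algebra all_fingroup.
From mathcomp Require Import boolp.
From mathcomp Require classical_sets.
Require Import Defs.

(** For a group [H] let [P = k[Hom(-, H)]_(Aut H)], with basis at [G] the kernels
    of epimorphisms [G -> H].  Morphisms [P -> M] are the [Aut H]-invariants of
    [M(H)], and as [k] has characteristic zero these depend exactly on [M], so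
    that [P] is a projective and compact object.  It vanishes at [G] if and only
    if [G] has no epimorphism onto [H].  As the unit is compact, so is the cone of
    the augmentation [P -> k]; it is acyclic at [H], where [P] is [k], but not at
    any [G] without an epimorphism onto [H].  If [p_H] is contained in [p_G], the
    cone for [H] yields an epimorphism [G -> H], and then [P] for [G] one
    [H -> G]; hence [G] and [H] are isomorphic.  Primality of [p_G] is the Kuenneth
    formula over [k].

    Compactness of both objects is one statement: attaching to a compact complex
    a free cell along an [Aut H]-invariant cycle keeps it compact.  A morphism
    out of the new complex into a coproduct is first truncated on the old
    complex, and then on the single remaining element of the coproduct that is
    the image of the cell. *)

Set Implicit Arguments.
Unset Strict Implicit.
Unset Printing Implicit Defensive.

Import GRing.Theory.
Local Open Scope ring_scope.

(** * Identities in abelian groups *)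

(** Identities in abelian groups are proved by reflection: both sides are reified over a common list
    of atoms, and agree once every atom has the same integer coefficient on each side. *)
Inductive zexpr := ZVar of nat | ZZero | ZAdd of zexpr & zexpr | ZOpp of zexpr.

Fixpoint zeval (V : zmodType) (env : seq V) (e : zexpr) : V :=
  match e with
  | ZVar i => env`_i
  | ZZero => 0
  | ZAdd a b => zeval env a + zeval env b
  | ZOpp a => - zeval env a
  end.

Fixpoint zcoef (e : zexpr) (i : nat) : int :=
  match e with
  | ZVar j => (i == j)%:Z
  | ZZero => 0
  | ZAdd a b => zcoef a i + zcoef b i
  | ZOpp a => - zcoef a i
  end.

Lemma zevalE (V : zmodType) (env : seq V) (e : zexpr) :
  zeval env e = \sum_(i < size env) env`_i *~ zcoef e i.
Proof.
elim: e => [j| |a IHa b IHb|a IHa] /=.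
- have [ltj|lej] := ltnP j (size env).
    rewrite (bigD1 (Ordinal ltj)) //= eqxx mulr1z big1 ?addr0 // => i.
    by rewrite -val_eqE /= => /negbTE ->.
  (* An index beyond [env] reads the default 0, matching a sum in which no coefficient is hit. *)
  rewrite nth_default // big1 // => i _.
  by rewrite ltn_eqF ?mulr0z // (leq_trans (ltn_ord i)).
- by rewrite big1.
- by rewrite IHa IHb -big_split; apply: eq_bigr => i _; rewrite mulrzDr.
- by rewrite IHa -sumrN; apply: eq_bigr => i _; rewrite mulrNz.
Qed.

Lemma zmod_correct (V : zmodType) (env : seq V) (a b : zexpr) :
  all (fun i => zcoef a i == zcoef b i) (iota 0 (size env)) ->
  zeval env a = zeval env b.
Proof.
move/allP => eqab; rewrite !zevalE; apply: eq_bigr => i _.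
by rewrite (eqP (eqab i _)) // mem_iota /= ltn_ord.
Qed.

Ltac zmod_index x env :=
  lazymatch env with
  | ?y :: ?t =>
      match goal with
      | _ => let _ := match goal with _ => unify x y end in constr:(0%N)
      | _ => let n := zmod_index x t in constr:(S n)
      end
  end.

Ltac zmod_atoms e env :=
  lazymatch e with
  | (?a + ?b)%R => let env' := zmod_atoms a env in zmod_atoms b env'
  | (- ?a)%R => zmod_atoms a env
  | 0%R => env
  | _ => match goal with
         | _ => let _ := zmod_index e env in env
         | _ => constr:(e :: env)
         end
  end.

Ltac zmod_reify e env :=
  lazymatch e with
  | (?a + ?b)%R =>
      let a' := zmod_reify a env in
      let b' := zmod_reify b env in constr:(ZAdd a' b')
  | (- ?a)%R => let a' := zmod_reify a env in constr:(ZOpp a')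
  | 0%R => constr:(ZZero)
  | _ => let n := zmod_index e env in constr:(ZVar n)
  end.

Ltac zmod :=
  lazymatch goal with
  | |- @eq ?T ?l ?r =>
      let env := zmod_atoms l (@nil T) in
      let env := zmod_atoms r env in
      let l' := zmod_reify l env in
      let r' := zmod_reify r env in
      exact: (@zmod_correct _ env l' r' isT)
  end.

(** * Complements and pseudo-inverses over a field *)

Section LinearAlgebra.
Variable k : fieldType.

Definition linfun_of (V W : lmodType k) (f : V -> W) (lf : linear f) :
    {linear V -> W} :=
  HB.pack_for {linear V -> W} f (GRing.isLinear.Build k V W *:%R f lf).

Definition subspace (V : lmodType k) (K : V -> Prop) : Prop :=
  K 0 /\ forall (a : k) u v, K u -> K v -> K (a *: u + v).

Lemma subspaceB (V : lmodType k) (K : V -> Prop) u v :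
  subspace K -> K u -> K v -> K (u - v).
Proof.
by move=> [_ KP] Ku Kv; rewrite addrC -scaleN1r; apply: KP.
Qed.

(** Zorn's lemma yields a maximal predicate closed under combinations and meeting [K] only in 0;
    maximality forces it to be a complement. *)
Lemma complement (V : lmodType k) (K : V -> Prop) : subspace K ->
  exists C : V -> Prop, [/\ subspace C,
    forall v, K v -> C v -> v = 0 &
    forall v, exists2 c, C c & K (v - c)].
Proof.
move=> sK.
(* Membership of 0 is not demanded, as the union of the empty chain has to be good too; it is
   recovered from maximality below. *)
pose good (C : V -> Prop) :=
  (forall (a : k) u v, C u -> C v -> C (a *: u + v)) /\
  (forall v, K v -> C v -> v = 0).
have [|C [[CP CK] Cmax]] := @classical_sets.Zorn_bigcup V good.
  move=> F Fgood Ftot; split.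
    move=> a u v [X FX Xu] [Y FY Yv].
    have [XY|YX] := Ftot X Y FX FY.
      by exists Y => //; apply: (proj1 (Fgood Y FY)) => //; apply: XY.
    by exists X => //; apply: (proj1 (Fgood X FX)) => //; apply: YX.
  by move=> v Kv [X FX Xv]; apply: (proj2 (Fgood X FX)).
pose span v := fun w : V => exists (a : k) (c : V), (c = 0 \/ C c) /\ w = a *: v + c.
(* Maximality in usable form: if adding the line through [v] creates no new intersection with [K],
   then [v] already lies in [C]. *)
have extP (v : V) : (forall a c, (c = 0 \/ C c) -> K (a *: v + c) -> a *: v + c = 0) ->
    C v.
  move=> Kspan; apply: contrapT => nCv.
  apply: (Cmax (span v)).
    split=> [w Cw|/(_ v) Cv].
      by exists 0, w; split; [right | rewrite scale0r add0r].
    by apply/nCv/Cv; exists 1, 0; split; [left | rewrite scale1r addr0].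
  split=> [b _ _ [a [c [Cc ->]]] [a' [c' [Cc' ->]]]|w Kw [a [c [Cc w_def]]]].
    exists (b * a + a'), (b *: c + c'); split.
      have [->|Cc0] := Cc; first by rewrite scaler0 add0r.
      have [->|Cc1] := Cc'; last by right; apply: CP.
      right; rewrite addr0 -[b](subrK 1) scalerDl scale1r.
      exact: CP.
    by rewrite scalerDr scalerDl scalerA addrACA.
  by rewrite w_def; apply: Kspan => //; rewrite -w_def.
have C0 : C 0.
  by apply: extP => a c; rewrite scaler0 add0r => -[-> //|Cc Kc]; apply: CK.
exists C; split=> // v; apply: contrapT => nv.
(* If [a *: v + c] were in [K] with [a] nonzero, dividing by [a] would decompose [v]. *)
have Cv : C v.
  apply: extP => a c Cc Kac.
  have {}Cc : C c by case: Cc => [->|].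
  have [a0|a_n0] := eqVneq a 0.
    by move: Kac; rewrite a0 scale0r add0r => Kc; apply: CK.
  case: nv; exists (- a^-1 *: c).
    by rewrite -[_ *: c]addr0; apply: CP.
  have -> : v - - a^-1 *: c = a^-1 *: (a *: v + c) + 0.
    by rewrite addr0 scalerDr scalerA mulVf // scale1r scaleNr opprK.
  by apply: (proj2 sK) => //; case: sK.
by case: nv; exists v => //; rewrite subrr; case: sK.
Qed.

(** With complements [C] of the kernel and [D] of the image, [t w] is the unique element of [C]
    whose image is the component of [w] in the image of [f]. *)
Lemma pseudo_inverse (V W : lmodType k) (f : {linear V -> W}) :
  exists t : {linear W -> V}, forall v, f (t (f v)) = f v.
Proof.
have [|C [sC CK CV]] := @complement V (fun v => f v = 0).
  by split=> [|a u v fu fv]; rewrite ?linear0 // linearP fu fv scaler0 addr0.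
have [|D [sD DI DV]] := @complement W (fun w => exists v, f v = w).
  split=> [|a _ _ [u <-] [v <-]]; first by exists 0; rewrite linear0.
  by exists (a *: u + v); rewrite linearP.
have tE w : exists c, C c /\ D (w - f c).
  have [d Dd [v fv]] := DV w; have [c Cc /eqP] := CV v.
  rewrite linearB subr_eq0 => /eqP fvc; exists c; split=> //.
  by rewrite -fvc fv subKr.
have tU w c c' : C c /\ D (w - f c) -> C c' /\ D (w - f c') -> c = c'.
  move=> [Cc Dc] [Cc' Dc']; apply/eqP; rewrite -subr_eq0; apply/eqP.
  apply: CK; last exact: subspaceB.
  apply: DI; first by exists (c - c').
  have -> : f (c - c') = (w - f c') - (w - f c) by rewrite linearB; zmod.
  exact: subspaceB.
pose t w := projT1 (cid (tE w)).
have tP w : C (t w) /\ D (w - f (t w)) := projT2 (cid (tE w)).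
have t_lin : linear t.
  move=> a u v; apply: (tU (a *: u + v)); first exact: tP.
  have [Cu Du] := tP u; have [Cv Dv] := tP v; split; first exact: (proj2 sC).
  have -> : a *: u + v - f (a *: t u + t v) =
            a *: (u - f (t u)) + (v - f (t v)).
    by rewrite linearP scalerBr; zmod.
  exact: (proj2 sD).
exists (linfun_of t_lin) => v /=.
have [_ Dv] := tP (f v).
apply/esym/eqP; rewrite -subr_eq0; apply/eqP.
by apply: DI => //; exists (v - t (f v)); rewrite linearB.
Qed.

(** A pseudo-inverse of [a |-> a *: v] does it: that map is injective when [v] is nonzero. *)
Lemma separating_functional (V : lmodType k) (v : V) : v != 0 ->
  exists phi : {linear V -> k^o}, phi v = 1.
Proof.
move=> v_n0.
have scale_lin : linear (fun a : k^o => a *: v).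
  by move=> a b c; rewrite scalerDl scalerA.
have [t /(_ 1) /= /eqP] := pseudo_inverse (linfun_of scale_lin).
rewrite scale1r -[X in _ == X]scale1r -subr_eq0 -scalerBl scaler_eq0.
by rewrite (negbTE v_n0) orbF subr_eq0 => /eqP tv; exists t.
Qed.

End LinearAlgebra.

(** * Complexes of functors *)

Section Complexes.
Variables (k : fieldType) (U : finGroupType -> Prop).
Implicit Types (M N : functor k U) (X Y Z : cx k U).

Definition mk_nt M N (f : forall G, M G -> N G) (f_lin : forall G, linear (f G))
    (f_nat : forall (G H : obj U) (e : epi G H) (x : M H),
       f G (fmap M e x) = fmap N e (f H x)) : nat_trans M N :=
  @NatTrans k U M N (fun G => linfun_of (f_lin G)) f_nat.

Section NatTransOps.
Variables M N : functor k U.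

Lemma nt_add_linear (f g : nat_trans M N) G : linear (fun x => f G x + g G x).
Proof. by move=> a x y; rewrite !linearP scalerDr addrACA. Qed.

Lemma nt_add_nat (f g : nat_trans M N) (G H : obj U) (e : epi G H) (x : M H) :
  f G (fmap M e x) + g G (fmap M e x) = fmap N e (f H x + g H x).
Proof. by rewrite linearD !nt_nat. Qed.

Definition nt_add f g : nat_trans M N :=
  mk_nt (nt_add_linear f g) (@nt_add_nat f g).

Lemma nt_opp_linear (f : nat_trans M N) G : linear (fun x => - f G x).
Proof. by move=> a x y; rewrite linearP opprD scalerN. Qed.

Lemma nt_opp_nat (f : nat_trans M N) (G H : obj U) (e : epi G H) (x : M H) :
  - f G (fmap M e x) = fmap N e (- f H x).
Proof. by rewrite linearN nt_nat. Qed.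

Definition nt_opp f : nat_trans M N := mk_nt (nt_opp_linear f) (@nt_opp_nat f).

Section NatTransSum.
Variables (I : Type) (s : seq I) (f : I -> nat_trans M N).

Lemma nt_sum_linear G : linear (fun x => \sum_(i <- s) f i G x).
Proof.
move=> a x y; rewrite scaler_sumr -big_split; apply: eq_bigr => i _.
by rewrite linearP.
Qed.

Lemma nt_sum_nat (G H : obj U) (e : epi G H) (x : M H) :
  \sum_(i <- s) f i G (fmap M e x) = fmap N e (\sum_(i <- s) f i H x).
Proof. by rewrite linear_sum; apply: eq_bigr => i _; rewrite nt_nat. Qed.

Definition nt_sum : nat_trans M N := mk_nt nt_sum_linear nt_sum_nat.
End NatTransSum.

End NatTransOps.

Section ProdFunctor.
Variables M N : functor k U.

Definition prod_fmap (G H : obj U) (e : epi G H) (x : M H * N H) : M G * N G :=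
  (fmap M e x.1, fmap N e x.2).

Lemma prod_fmap_linear (G H : obj U) (e : epi G H) : linear (prod_fmap e).
Proof. by move=> a x y; rewrite /prod_fmap /= !linearP. Qed.

Lemma prod_fmap_conj (G H : obj U) (f g : epi G H) :
  epi_conj f g -> prod_fmap f =1 prod_fmap g.
Proof. by move=> fg x; rewrite /prod_fmap !(fmap_conj fg). Qed.

Lemma prod_fmap_id (G : obj U) : prod_fmap (epi_id G) =1 id.
Proof. by move=> [x y]; rewrite /prod_fmap /= !fmap_id. Qed.

Lemma prod_fmap_comp (G H K : obj U) (g : epi H K) (f : epi G H) :
  @prod_fmap G K (epi_comp g f) =1 prod_fmap f \o prod_fmap g.
Proof. by move=> x; rewrite /prod_fmap /= !fmap_comp. Qed.

Definition prod_functor : functor k U :=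
  @Functor k U (fun G => (M G * N G)%type : lmodType k)
    (fun G H e => linfun_of (@prod_fmap_linear G H e))
    prod_fmap_conj prod_fmap_id prod_fmap_comp.
End ProdFunctor.

Section DegreeCast.
Variable F : int -> functor k U.

(* The identity of [F n] if [m = n], and zero otherwise: this replaces
   transports along equalities between degrees. *)
Definition deg_cast (n m : int) : nat_trans (F n) (F m) :=
  if n =P m is ReflectT e then
    eq_rect n (fun m => nat_trans (F n) (F m)) (nt_id (F n)) m e
  else nt_zero (F n) (F m).

Lemma deg_cast_id n G (x : F n G) : deg_cast n n G x = x.
Proof. by rewrite /deg_cast; case: eqP => // e; rewrite (eq_axiomK e). Qed.

Lemma deg_cast_ne n m G (x : F n G) : n != m -> deg_cast n m G x = 0.
Proof. by rewrite /deg_cast; case: eqP. Qed.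
End DegreeCast.

(** Quantifying over all degrees avoids the arithmetic of [n - 1] and [n + 1]; by [cd_shape] only
    the adjacent degree contributes. *)
Definition is_closed X n G (x : X n G) : Prop := forall m, cd X n m G x = 0.
Definition is_exact X n G (x : X n G) : Prop := exists m (y : X m G), cd X m n G y = x.

Lemma cycleP X n G (x : X n G) : cycle x <-> is_closed x.
Proof.
split=> [cx m|]; last exact.
have [nm|nm] := eqVneq n (m + 1); last exact: cd_shape.
by subst n; move: cx; rewrite /cycle addrK.
Qed.

Lemma boundaryP X n G (x : X n G) : boundary x <-> is_exact x.
Proof.
split=> [[y <-]|[m [y <-]]]; first by exists (n + 1), y.
have [nm|nm] := eqVneq m (n + 1); first by subst m; exists y.
by exists 0; rewrite linear0 cd_shape.
Qed.

Lemma exact0 X n G : is_exact (0 : X n G).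
Proof. by exists n, 0; rewrite linear0. Qed.

Lemma exact_lift X n G (x : X n G) : is_exact x -> exists y, cd X (n + 1) n G y = x.
Proof. by move/boundaryP. Qed.

Lemma exactD X n G (x y : X n G) : is_exact x -> is_exact y -> is_exact (x + y).
Proof.
by move=> /exact_lift[u <-] /exact_lift[v <-]; exists (n + 1), (u + v); rewrite linearD.
Qed.

Lemma exactN X n G (x : X n G) : is_exact x -> is_exact (- x).
Proof. by move=> [m [u <-]]; exists m, (- u); rewrite linearN. Qed.

Lemma exactB X n G (x y : X n G) : is_exact x -> is_exact y -> is_exact (x - y).
Proof. by move=> ex ey; apply: exactD => //; apply: exactN. Qed.

Lemma closedB X n G (x y : X n G) : is_closed x -> is_closed y -> is_closed (x - y).
Proof. by move=> cx cy m; rewrite linearB cx cy subrr. Qed.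

Lemma closed_d X n m G (x : X n G) : is_closed (cd X n m G x).
Proof. by move=> p; rewrite cd2. Qed.

Lemma exact_d X n m G (x : X n G) : is_exact (cd X n m G x).
Proof. by exists n, x. Qed.

Lemma closed_deg_cast X n m G (x : X n G) : is_closed x -> is_closed (deg_cast X n m G x).
Proof.
have [<-|nm] := eqVneq n m; first by rewrite deg_cast_id.
by move=> _ p; rewrite deg_cast_ne // linear0.
Qed.

Lemma closed_ch X Y (f : chmap X Y) n G (x : X n G) : is_closed x -> is_closed (f n G x).
Proof. by move=> cx m; rewrite -ch_comm cx linear0. Qed.

Lemma exact_ch X Y (f : chmap X Y) n G (x : X n G) : is_exact x -> is_exact (f n G x).
Proof. by move=> [m [y <-]]; exists m, (f m G y); rewrite ch_comm. Qed.

Lemma quasi_isoP X Y (f : chmap X Y) : quasi_iso f <->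
  forall n G,
    (forall x : X n G, is_closed x -> is_exact (f n G x) -> is_exact x) /\
    (forall y : Y n G, is_closed y -> exists2 x, is_closed x & is_exact (f n G x - y)).
Proof.
split=> qf n G; have [inj sur] := qf n G; split.
- by move=> x /cycleP cx /boundaryP bx; apply/boundaryP/inj.
- move=> y /cycleP cy; have [x /cycleP cx /boundaryP bx] := sur y cy.
  by exists x.
- by move=> x /cycleP cx /boundaryP bx; apply/boundaryP/inj.
- move=> y /cycleP cy; have [x /cycleP cx /boundaryP bx] := sur y cy.
  by exists x.
Qed.

(** Neighbouring degrees become variables tied by equations, so that they can be substituted
    away. *)
Lemma homotopicP X Y (f g : chmap X Y) : homotopic f g <->
  exists h : forall n m, nat_trans (X n) (Y m),
  forall (n p m : int) (G : obj U) (x : X n G), n = m + 1 -> p = n + 1 ->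
    f n G x - g n G x = cd Y p n G (h n p G x) + h m n G (cd X n m G x).
Proof.
split=> -[h hP]; exists h.
  by move=> n p m G x nm ->; rewrite hP; subst n; rewrite addrK.
by move=> n G x; apply: hP => //; rewrite subrK.
Qed.

Lemma homotopic_exact X Y (f g : chmap X Y) n G (x : X n G) :
  homotopic f g -> is_closed x -> is_exact (f n G x - g n G x).
Proof.
by move=> [h ->] cx; rewrite cx linear0 addr0; apply: exact_d.
Qed.

Lemma eq_homotopic X Y (f g : chmap X Y) :
  (forall n G x, f n G x = g n G x) -> homotopic f g.
Proof.
move=> fg; exists (fun n m => nt_zero (X n) (Y m)) => n G x.
by rewrite fg subrr /= linear0 addr0.
Qed.

Lemma homotopic_refl X Y (f : chmap X Y) : homotopic f f.
Proof. exact: eq_homotopic. Qed.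

Lemma homotopic_sym X Y (f g : chmap X Y) : homotopic f g -> homotopic g f.
Proof.
move=> [h hP]; exists (fun n m => nt_opp (h n m)) => n G x /=.
by rewrite linearN -opprD -hP opprB.
Qed.

Lemma homotopic_trans X Y (f g e : chmap X Y) :
  homotopic f g -> homotopic g e -> homotopic f e.
Proof.
move=> [h hP] [h' hP']; exists (fun n m => nt_add (h n m) (h' n m)) => n G x /=.
by rewrite linearD addrACA -hP -hP'; zmod.
Qed.

Lemma homotopic_compl X Y Z (e : chmap Y Z) (f g : chmap X Y) :
  homotopic f g -> homotopic (ch_comp e f) (ch_comp e g).
Proof.
move=> [h hP]; exists (fun n m => nt_comp (e m) (h n m)) => n G x /=.
by rewrite -linearB hP linearD ch_comm.
Qed.

Lemma homotopic_compr X Y Z (e : chmap X Y) (f g : chmap Y Z) :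
  homotopic f g -> homotopic (ch_comp f e) (ch_comp g e).
Proof.
move=> [h hP]; exists (fun n m => nt_comp (h n m) (e n)) => n G x /=.
by rewrite hP ch_comm.
Qed.

Lemma quasi_iso_homotopic X Y (f g : chmap X Y) :
  homotopic f g -> quasi_iso f -> quasi_iso g.
Proof.
move=> fg /quasi_isoP qf; apply/quasi_isoP => n G; have [inj sur] := qf n G.
split=> [x cx ex|y cy].
  apply: inj => //; rewrite -[f n G x](subrK (g n G x)); apply: exactD => //.
  exact: homotopic_exact.
have [x cx ex] := sur y cy; exists x => //.
have -> : g n G x - y = (f n G x - y) - (f n G x - g n G x) by zmod.
by apply: exactB => //; apply: homotopic_exact.
Qed.

Lemma quasi_iso_cancell X Y Z (g : chmap Y Z) (f : chmap X Y) :
  quasi_iso g -> quasi_iso (ch_comp g f) -> quasi_iso f.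
Proof.
move=> /quasi_isoP qg /quasi_isoP qgf; apply/quasi_isoP => n G.
have [ig _] := qg n G; have [igf sgf] := qgf n G.
split=> [x cx ex|y cy]; first by apply: igf => //; exact: (exact_ch g ex).
have [x cx ex] := sgf _ (closed_ch g cy); exists x => //.
apply: ig; first by apply: closedB => //; apply: closed_ch.
by rewrite linearB.
Qed.

(** ** Homotopy pullbacks *)

Section HomotopyPullback.
Variables (A Z C : cx k U) (i : chmap A C) (t : chmap Z C).

(** The homotopy fibre of [i - t]: a cycle is a pair of cycles of [A] and [Z] with a chain of [C]
    bounding the difference of their images. *)
Definition hpb_functor n : functor k U :=
  prod_functor (prod_functor (A n) (Z n)) (C (n + 1)).

Definition hpb_dfun n m G (x : hpb_functor n G) : hpb_functor m G :=
  (cd A n m G x.1.1, cd Z n m G x.1.2,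
   deg_cast C n (m + 1) G (i n G x.1.1 - t n G x.1.2) -
   cd C (n + 1) (m + 1) G x.2).

Lemma hpb_d_linear n m G : linear (@hpb_dfun n m G).
Proof.
move=> a x y; rewrite /hpb_dfun /= !linearP.
congr (_, _, _) => /=.
by rewrite addrACA -scalerDr linearP addrACA -scalerDr.
Qed.

Lemma hpb_d_nat n m (G H : obj U) (e : epi G H) (x : hpb_functor n H) :
  hpb_dfun m (fmap (hpb_functor n) e x) = fmap (hpb_functor m) e (hpb_dfun m x).
Proof.
by rewrite /hpb_dfun /= /prod_fmap /= !nt_nat -linearB nt_nat -linearB.
Qed.

Definition hpb_d n m : nat_trans (hpb_functor n) (hpb_functor m) :=
  mk_nt (@hpb_d_linear n m) (@hpb_d_nat n m).

Lemma hpb_d_shape (n m : int) (G : obj U) (x : hpb_functor n G) :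
  n != m + 1 -> hpb_d n m G x = 0.
Proof.
move=> nm; rewrite /= /hpb_dfun !(cd_shape _ nm) deg_cast_ne // cd_shape ?subr0 //.
by apply: contra nm => /eqP/addIr ->.
Qed.

Lemma hpb_d2 (n m p : int) (G : obj U) (x : hpb_functor n G) :
  hpb_d m p G (hpb_d n m G x) = 0.
Proof.
have [nm|nm] := eqVneq n (m + 1); last by rewrite (hpb_d_shape _ nm) linear0.
have [mp|mp] := eqVneq m (p + 1); last by rewrite hpb_d_shape.
subst n; subst m; rewrite /= /hpb_dfun /= !cd2 !deg_cast_id linearB cd2.
by rewrite subr0 linearB !ch_comm subrr.
Qed.

Definition hpb : cx k U := Cx hpb_d_shape hpb_d2.

Lemma hpb_fst_linear n G : linear (fun x : hpb n G => x.1.1).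
Proof. by []. Qed.

Lemma hpb_snd_linear n G : linear (fun x : hpb n G => x.1.2).
Proof. by []. Qed.

Lemma hpb_htpy_linear n m G : linear (fun x : hpb n G => deg_cast C (n + 1) m G x.2).
Proof. by move=> a x y; rewrite linearP. Qed.

Definition hpb_fst : chmap hpb A :=
  @Chmap k U hpb A
    (fun n => @mk_nt (hpb n) (A n) _ (@hpb_fst_linear n) (fun G H e x => erefl))
    (fun n m G x => erefl).

Definition hpb_snd : chmap hpb Z :=
  @Chmap k U hpb Z
    (fun n => @mk_nt (hpb n) (Z n) _ (@hpb_snd_linear n) (fun G H e x => erefl))
    (fun n m G x => erefl).

Lemma hpb_htpy_nat n m (G H : obj U) (e : epi G H) (x : hpb n H) :
  deg_cast C (n + 1) m G (fmap (hpb n) e x).2 =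
  fmap (C m) e (deg_cast C (n + 1) m H x.2).
Proof. by rewrite -nt_nat. Qed.

Lemma hpb_homotopic : homotopic (ch_comp i hpb_fst) (ch_comp t hpb_snd).
Proof.
apply/homotopicP.
exists (fun n m => mk_nt (@hpb_htpy_linear n m) (@hpb_htpy_nat n m)).
move=> n p m G x nm ->; subst n => /=.
by rewrite !deg_cast_id; zmod.
Qed.

Lemma quasi_iso_hpb_fst : quasi_iso t -> quasi_iso hpb_fst.
Proof.
move=> /quasi_isoP qt; apply/quasi_isoP => n G; split.
  move=> [[a z] c] cx /exact_lift /= [a' a'E].
  have := cx (n - 1); have [n' nE] : exists n', n = n' + 1.
    by exists (n - 1); rewrite subrK.
  subst n; rewrite addrK /= /hpb_dfun /= deg_cast_id => -[da dz dc].
  (* Correcting [c] by [i a'] exhibits [t z] as a boundary, so [z] itself bounds some [z']. *)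
  pose y := c - i _ G a'.
  have dy : cd C (n' + 1 + 1) (n' + 1) G y = - t (n' + 1) G z.
    move/eqP: dc; rewrite subr_eq0 => /eqP dc.
    by rewrite linearB -dc -ch_comm a'E; zmod.
  have [inj _] := qt (n' + 1) G.
  have cz : is_closed z by move=> m; case: (cx m).
  have [z' z'E] : exists z', cd Z (n' + 1 + 1) (n' + 1) G z' = z.
    apply: exact_lift; apply: inj => //.
    by rewrite -[t _ _ _]opprK -dy; apply/exactN/exact_d.
  have [_ sur] := qt (n' + 1 + 1) G.
  (* The remaining defect [- y - t z'] is a cycle, hence homologous to the image of a cycle [z''],
     which is absorbed into the [Z]-component. *)
  have [z'' cz'' /exact_lift [c' c'E]] : exists2 z'', is_closed z'' &
      is_exact (t _ G z'' - (- y - t _ G z')).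
    apply: sur => m; have [mE|mE] := eqVneq (n' + 1 + 1) (m + 1).
      move/addIr: mE => <-.
      by rewrite linearB linearN dy opprK -ch_comm z'E subrr.
    exact: cd_shape.
  exists (n' + 1 + 1), (a', z' + z'', - c') => /=.
  rewrite /hpb_dfun /= deg_cast_id a'E linearD z'E cz'' addr0 linearN c'E linearD.
  by congr (_, _, _); rewrite /y; zmod.
move=> a ca.
have [_ sur] := qt n G.
(* The class of [i a] lifts along [t] to a cycle [z]; the chain [c] comparing them completes [a] to
   a cycle of the pullback. *)
have [z cz /exact_lift [c cE]] := sur _ (closed_ch i ca).
exists (a, z, - c); last by rewrite /= subrr; apply: exact0.
move=> m /=; have [nm|nm] := eqVneq n (m + 1); last exact: hpb_d_shape.
subst n; rewrite /hpb_dfun /= deg_cast_id ca cz linearN cE opprK.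
by congr (_, _, _); zmod.
Qed.

End HomotopyPullback.

(** The Ore condition, by which fractions are compared over a common denominator. *)
Lemma ore_square (A Z C : cx k U) (i : chmap A C) (t : chmap Z C) :
  quasi_iso t -> exists (V : cx k U) (a : chmap V A) (b : chmap V Z),
    quasi_iso a /\ homotopic (ch_comp i a) (ch_comp t b).
Proof.
move=> qt; exists (hpb i t), (hpb_fst i t), (hpb_snd i t); split.
  exact: quasi_iso_hpb_fst.
exact: hpb_homotopic.
Qed.

End Complexes.

(** * Coproducts and compactness *)

Lemma big_uniq_sub (V : nmodType) (I : eqType) (s r : seq I) (F : I -> V) :
  uniq s -> uniq r -> {subset s <= r} ->
  \sum_(i <- s) F i = \sum_(i <- r) (if i \in s then F i else 0).
Proof.
move=> us ur sr; rewrite -big_mkcond -big_filter; apply: perm_big.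
apply: uniq_perm => //; first exact: filter_uniq.
by move=> i; rewrite mem_filter; case: (boolP (i \in s)) => // /sr ->.
Qed.

Section Compactness.
Variables (k : fieldType) (U : finGroupType -> Prop).
Implicit Types X Z W : cx k U.

Lemma ch_sum_comm X Z (I : Type) (s : seq I) (f : I -> chmap X Z)
    (n m : int) (G : obj U) (x : X n G) :
  nt_sum s (fun i => f i m) G (cd X n m G x) =
  cd Z n m G (nt_sum s (fun i => f i n) G x).
Proof. by rewrite /= linear_sum; apply: eq_bigr => i _; rewrite ch_comm. Qed.

Definition ch_sum X Z (I : Type) (s : seq I) (f : I -> chmap X Z) : chmap X Z :=
  @Chmap k U X Z (fun n => nt_sum s (fun i => f i n)) (@ch_sum_comm X Z I s f).

Section Coproduct.
Variables (I : choiceType) (Y : I -> cx k U) (S : cx k U).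
Variable inj : forall i, chmap (Y i) S.
Hypothesis injP : is_coproduct inj.

Lemma coproduct_uniq n G (s s' : seq I) (c c' : forall i, Y i n G) :
  uniq s -> uniq s' ->
  \sum_(i <- s) inj i n G (c i) = \sum_(i <- s') inj i n G (c' i) ->
  forall i, (if i \in s then c i else 0) = (if i \in s' then c' i else 0).
Proof.
move=> us us' e i; pose r := undup (s ++ s').
have ur : uniq r by apply: undup_uniq.
have sr : {subset s <= r} by move=> j js; rewrite mem_undup mem_cat js.
have s'r : {subset s' <= r} by move=> j js; rewrite mem_undup mem_cat js orbT.
have [_ /(_ r) injI] := injP n G.
have [ir|] := boolP (i \in r); last first.
  by rewrite mem_undup mem_cat negb_or => /andP[/negbTE -> /negbTE ->].
apply/eqP; rewrite -subr_eq0; apply/eqP; move: i ir.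
apply: (injI (fun i => (if i \in s then c i else 0) -
                       (if i \in s' then c' i else 0))) => //.
move/eqP: e; rewrite -subr_eq0 (big_uniq_sub _ us ur sr).
rewrite (big_uniq_sub _ us' ur s'r) -sumrB => /eqP e0; rewrite -[RHS]e0.
apply: eq_bigr => j _; rewrite linearB.
by congr (_ - _); case: ifP; rewrite ?linear0.
Qed.

(** [is_coproduct] provides injections only; the uniqueness of finite expansions gives the
    projections as well. *)
Lemma coord_ex n G i (y : S n G) : exists z : Y i n G,
  forall s (c : forall i, Y i n G), uniq s ->
    y = \sum_(i <- s) inj i n G (c i) -> z = if i \in s then c i else 0.
Proof.
have [/(_ y)[s [c [us yE]]] _] := injP n G.
exists (if i \in s then c i else 0) => s' c' us' yE'.
by apply: coproduct_uniq => //; rewrite -yE.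
Qed.

Definition coord i n G (y : S n G) : Y i n G := projT1 (cid (coord_ex i y)).

Lemma coord_sum n G (s : seq I) (c : forall i, Y i n G) i : uniq s ->
  coord i (\sum_(j <- s) inj j n G (c j)) = if i \in s then c i else 0.
Proof. by move=> us; rewrite /coord; case: cid => z /= /(_ s c us); apply. Qed.

Lemma coord_fin n G (y : S n G) : exists s, [/\ uniq s,
  forall i, i \notin s -> coord i y = 0 &
  forall r, uniq r -> {subset s <= r} -> y = \sum_(i <- r) inj i n G (coord i y)].
Proof.
have [/(_ y)[s [c [us yE]]] _] := injP n G.
exists s; split=> // [i /negbTE nis|r ur sr]; first by rewrite yE coord_sum // nis.
rewrite {1}yE (big_uniq_sub _ us ur sr); apply: eq_bigr => i _.
by rewrite yE coord_sum //; case: ifP; rewrite // linear0.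
Qed.

Lemma coord_sum2 n G (y y' : S n G) : exists s, [/\ uniq s,
  y = \sum_(i <- s) inj i n G (coord i y),
  y' = \sum_(i <- s) inj i n G (coord i y') &
  forall i, i \notin s -> coord i y = 0 /\ coord i y' = 0].
Proof.
have [s [us s0 sE]] := coord_fin y; have [s' [us' s'0 s'E]] := coord_fin y'.
exists (undup (s ++ s')); split; first exact: undup_uniq.
- by apply: sE; rewrite ?undup_uniq // => i; rewrite mem_undup mem_cat => ->.
- by apply: s'E; rewrite ?undup_uniq // => i; rewrite mem_undup mem_cat orbC => ->.
- by move=> i; rewrite mem_undup mem_cat negb_or => /andP[/s0 -> /s'0 ->].
Qed.

Lemma coord_linear i n G : linear (@coord i n G).
Proof.
move=> a x y; have [s [us xE yE s0]] := coord_sum2 x y.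
have -> : a *: x + y = \sum_(j <- s) inj j n G (a *: coord j x + coord j y).
  rewrite {1}xE {1}yE scaler_sumr -big_split; apply: eq_bigr => j _.
  by rewrite linearP.
rewrite coord_sum //; case: ifPn => // /s0[-> ->].
by rewrite scaler0 addr0.
Qed.

Lemma coord_nat i n (G H : obj U) (e : epi G H) (x : S n H) :
  coord i (fmap (S n) e x) = fmap (Y i n) e (coord i x).
Proof.
have [s [us s0 /(_ s us) xE]] := coord_fin x.
rewrite {1}xE // linear_sum.
under eq_bigr do rewrite -nt_nat.
by rewrite coord_sum //; case: ifPn => // /s0 ->; rewrite linear0.
Qed.

Lemma coord_comm i (n m : int) (G : obj U) (x : S n G) :
  coord i (cd S n m G x) = cd (Y i) n m G (coord i x).
Proof.
have [s [us s0 /(_ s us) xE]] := coord_fin x.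
rewrite {1}xE // linear_sum.
under eq_bigr do rewrite -ch_comm.
by rewrite coord_sum //; case: ifPn => // /s0 ->; rewrite linear0.
Qed.

Definition ch_coord i : chmap S (Y i) :=
  @Chmap k U S (Y i) (fun n => mk_nt (@coord_linear i n) (@coord_nat i n))
    (@coord_comm i).

Lemma coord_inj n G (y y' : S n G) : (forall i, coord i y = coord i y') -> y = y'.
Proof.
move=> e; have [s [us -> -> _]] := coord_sum2 y y'.
by apply: eq_bigr => i _; rewrite e.
Qed.

Definition trunc (s : seq I) : chmap S S :=
  ch_sum s (fun i => ch_comp (inj i) (ch_coord i)).

Lemma coord_trunc (s : seq I) i n G (y : S n G) : uniq s ->
  coord i (trunc s n G y) = if i \in s then coord i y else 0.
Proof. exact: coord_sum. Qed.

Lemma trunc_trunc (s r : seq I) n G (y : S n G) :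
  uniq s -> uniq r -> {subset s <= r} ->
  trunc r n G (trunc s n G y) = trunc s n G y.
Proof.
move=> us ur sr; apply: coord_inj => i; rewrite !coord_trunc //.
by case: ifPn => // nir; case: ifP => // /sr; rewrite (negbTE nir).
Qed.

Lemma trunc_id n G (y : S n G) : exists s, uniq s /\
  forall r, uniq r -> {subset s <= r} -> trunc r n G y = y.
Proof.
have [s [us s0 sE]] := coord_fin y; exists s; split=> // r ur sr.
exact/esym/sE.
Qed.

End Coproduct.

(* Compactness, with the factorization through a finite subsum expressed by
   the idempotent [trunc s] of the coproduct. *)
Definition finitely_factoring X : Prop :=
  forall (I : choiceType) (Y : I -> cx k U) (S : cx k U)
    (inj : forall i, chmap (Y i) S) (injP : is_coproduct inj)
    Z (t : chmap Z X) (g : chmap Z S), quasi_iso t ->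
  exists W (w : chmap W Z) s, [/\ quasi_iso w, uniq s &
    homotopic (ch_comp g w) (ch_comp (trunc injP s) (ch_comp g w))].

Lemma roof_eq_refl X Z (r : roof X Z) : roof_eq r r.
Proof.
exists (apex r), (ch_id _), (ch_id _).
by split; [exact: quasi_iso_id | exact: homotopic_refl | exact: homotopic_refl].
Qed.

Lemma roof_eq_sym X Z (r s : roof X Z) : roof_eq r s -> roof_eq s r.
Proof.
move=> [W [u [v [qu hd hn]]]]; exists W, v, u; split; try exact: homotopic_sym.
apply: (quasi_iso_cancell (den_qi s)); apply: quasi_iso_homotopic hd _.
exact: quasi_iso_comp (den_qi r) qu.
Qed.

(** An Ore square over the middle apex merges the two refinements. *)
Lemma roof_eq_trans X Z (r s t : roof X Z) :
  roof_eq r s -> roof_eq s t -> roof_eq r t.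
Proof.
move=> [W [u [v [qu hd hn]]]] [W' [u' [v' [qu' hd' hn']]]].
have [V [a [b [qa ab]]]] := ore_square v qu'.
exists V, (ch_comp u a), (ch_comp v' b); split; first exact: quasi_iso_comp.
- apply: (homotopic_trans (homotopic_compr a hd)).
  apply: (homotopic_trans (homotopic_compl (den s) ab)).
  exact: (homotopic_compr b hd').
- apply: (homotopic_trans (homotopic_compr a hn)).
  apply: (homotopic_trans (homotopic_compl (num s) ab)).
  exact: (homotopic_compr b hn').
Qed.

Lemma compact_finitely_factoring X : compact X -> finitely_factoring X.
Proof.
move=> cX I Y S inj injP Z t g qt.
have [/(_ (Roof g qt))[s [phi [us [Z' [t' [qt' [a [b [_ bE e]]]]]]]]] _] :=
  cX I Y S inj injP.
have [W [u [v [qu hd hn]]]] := e; exists W, v, s; split=> //=.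
  by case: (roof_eq_sym e) => ? [? [? []]] *; apply: (quasi_iso_cancell qt);
     apply: quasi_iso_homotopic hd _; apply: quasi_iso_comp.
(* The numerator [b] is a sum over [s], so truncating to [s] fixes it; this passes to [g] along the
   homotopy. *)
have bT n G z : trunc injP s n G (b n G z) = b n G z.
  apply: (coord_inj (injP := injP)) => i; rewrite coord_trunc // bE coord_sum //.
  by case: (i \in s).
apply: (homotopic_trans (homotopic_sym hn)).
apply: homotopic_trans (homotopic_compl (trunc injP s) hn).
by apply: eq_homotopic => n G x; rewrite /= -[LHS]bT.
Qed.

(** For surjectivity, the components of a truncated numerator are its coordinates. For injectivity,
    projecting a homotopy between two sums to a coordinate compares the individual summands. *)
Lemma finitely_factoring_compact X : finitely_factoring X -> compact X.
Proof.
move=> fX I Y S inj injP; split.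
  move=> r; have [W [w [s [qw us h]]]] := fX I Y S inj injP _ _ (num r) (den_qi r).
  have qt := quasi_iso_comp (den_qi r) qw.
  pose a i := ch_comp (ch_coord injP i) (ch_comp (num r) w).
  exists s, (fun i => Roof (a i) qt); split=> //.
  exists W, _, qt, a, (ch_comp (trunc injP s) (ch_comp (num r) w)).
  split=> // [i _|]; first exact: roof_eq_refl.
  exists W, (ch_id W), w; split; first exact: quasi_iso_id.
    exact: homotopic_refl.
  exact: homotopic_sym.
move=> s phi psi r us [Z [t [qt [a [b [aphi bE br]]]]]].
move=> [Z' [t' [qt' [a' [b' [apsi bE' br']]]]]] i si.
have coordE (V : cx k U) (f : forall i, chmap V (Y i)) (g : chmap V S) :
    (forall n G z, g n G z = \sum_(i <- s) inj i n G (f i n G z)) ->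
    forall n G z, ch_coord injP i n G (g n G z) = f i n G z.
  by move=> gE n G z; rewrite gE [LHS]coord_sum // si.
apply: roof_eq_trans (roof_eq_sym (aphi i si)) _.
apply: roof_eq_trans (apsi i si).
have [V [u [v [qu hd hn]]]] := roof_eq_trans br (roof_eq_sym br').
exists V, u, v; split=> //.
have h : homotopic (ch_comp (a i) u) (ch_comp (ch_coord injP i) (ch_comp b u)).
  by apply: eq_homotopic => n G z; rewrite [RHS](coordE _ _ _ bE).
apply: homotopic_trans h _.
apply: homotopic_trans (homotopic_compl (ch_coord injP i) hn) _.
by apply: eq_homotopic => n G z; rewrite [LHS](coordE _ _ _ bE').
Qed.

End Compactness.

(** * Epimorphisms of finite groups *)

Section Epis.
Implicit Types G H : finGroupType.

Lemma epi1 G H (f : epi G H) : f 1%g = 1%g.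
Proof. by apply: (@mulgI _ (f 1%g)); rewrite -epiM !mulg1. Qed.

Lemma epiV G H (f : epi G H) x : f x^-1%g = (f x)^-1%g.
Proof. by apply: (@mulgI _ (f x)); rewrite -epiM !mulgV epi1. Qed.

Lemma epiJ G H (f : epi G H) x y : f (x ^ y)%g = (f x ^ f y)%g.
Proof. by rewrite !conjgE !epiM epiV. Qed.

Lemma epi_inj G H (f : epi G H) : (#|G| <= #|H|)%N -> injective f.
Proof.
move=> leGH; pose g y := projT1 (cid (epi_surj f y)).
have gK : cancel g f by move=> y; rewrite /g; case: cid.
have [g' gK' g'K] := inj_card_bij (can_inj gK) leGH.
by move=> x y fxy; rewrite -[x]g'K -[y]g'K -[g' x]gK -[g' y]gK !g'K fxy.
Qed.

Lemma isog_epi G H : [set: G] \isog [set: H] ->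
  exists (f : epi G H) (g : epi H G), cancel f g /\ cancel g f.
Proof.
case/isogP => f injf fG.
have fS y : exists x, f x = y.
  have : y \in (f @* [set: G])%g by rewrite fG inE.
  by case/morphimP => x _ _ ->; exists x.
have fM : {morph f : x y / (x * y)%g} by move=> x y; apply: morphM; rewrite inE.
have fI : injective f by move=> x y; apply: (injmP injf); rewrite inE.
pose g y := projT1 (cid (fS y)).
have gK : cancel g f by move=> y; rewrite /g; case: cid.
have fK : cancel f g by move=> x; apply: fI; rewrite gK.
have gM : {morph g : x y / (x * y)%g} by move=> x y; apply: fI; rewrite fM !gK.
have gS x : exists y, g y = x by exists (f x).
by exists (Epi fM fS), (Epi gM gS).
Qed.

Lemma epi_homg G H (f : epi G H) : homg [set: H] [set: G].
Proof.
have fM : {in [set: G] &, {morph f : x y / (x * y)%g}} by move=> x y _ _; apply: epiM.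
have -> : [set: H] = (Morphism fM @* [set: G])%g.
  apply/esym/setP => y; rewrite inE; have [x <-] := epi_surj f y.
  by apply/morphimP; exists x; rewrite ?inE.
exact: morphim_homg.
Qed.

Lemma epi_card G H (f : epi G H) : (#|H| <= #|G|)%N.
Proof.
by have := leq_homg (epi_homg f); rewrite !cardsT.
Qed.

Lemma epi_isog G H : epi G H -> epi H G -> [set: G] \isog [set: H].
Proof.
move=> f g; rewrite isogEcard (epi_homg g) !cardsT.
exact: epi_card.
Qed.

Definition ker_set G H (f : epi G H) : {set G} := [set x | f x == 1%g].

Lemma ker_setP G H (f : epi G H) x y :
  (f x == f y) = ((x^-1 * y)%g \in ker_set f).
Proof. by rewrite inE epiM epiV eq_sym -eq_mulVg1 eq_sym. Qed.

(** The factor is read off on preimages under [f]. As a surjection of a finite group onto itself it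
    is an automorphism. *)
Lemma eq_ker_factor G H (f g : epi G H) : ker_set f = ker_set g ->
  exists b : epi H H, forall x, g x = b (f x).
Proof.
move=> fg; have fgP x y : f x = f y -> g x = g y.
  by move/eqP; rewrite ker_setP fg -ker_setP => /eqP.
pose b y := g (projT1 (cid (epi_surj f y))).
have bf x : g x = b (f x) by apply: fgP; case: cid.
have bM : {morph b : x y / (x * y)%g}.
  move=> x y; have [u <-] := epi_surj f x; have [v <-] := epi_surj f y.
  by rewrite -epiM -!bf epiM.
have bS y : exists x, b x = y.
  by have [x <-] := epi_surj g y; exists (f x).
by exists (Epi bM bS).
Qed.

End Epis.

(** * Invariants, averaging and the functors generated by a group *)

Section FunctorTheory.
Variables (k : fieldType) (U : finGroupType -> Prop).
Implicit Types M N : functor k U.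

Lemma eq_fmap M (G H : obj U) (f g : epi G H) : f =1 g -> fmap M f =1 fmap M g.
Proof. by move=> fg; apply: fmap_conj; exists 1%g => x; rewrite conjg1 fg. Qed.

(** Surjective endomorphisms of a finite group are automorphisms, so these are the
    [Aut H]-invariants of [M H]. *)
Definition invariant M (H : obj U) (m : M H) : Prop :=
  forall b : epi H H, fmap M b m = m.

Lemma invariantD M (H : obj U) (m m' : M H) :
  invariant m -> invariant m' -> invariant (m + m').
Proof. by move=> im im' b; rewrite linearD im im'. Qed.

Lemma invariantN M (H : obj U) (m : M H) : invariant m -> invariant (- m).
Proof. by move=> im b; rewrite linearN im. Qed.

Lemma invariant0 M (H : obj U) : invariant (0 : M H).
Proof. by move=> b; rewrite linear0. Qed.

Lemma invariant_nt M N (f : nat_trans M N) (H : obj U) (m : M H) :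
  invariant m -> invariant (f H m).
Proof. by move=> im b; rewrite -nt_nat im. Qed.

Lemma invariant_ker M (G H : obj U) (m : M H) (f g : epi G H) :
  invariant m -> ker_set f = ker_set g -> fmap M f m = fmap M g m.
Proof.
move=> im /eq_ker_factor[b gE].
by rewrite (eq_fmap (g := epi_comp b f) gE) fmap_comp /= im.
Qed.

(** ** Averaging over automorphisms *)

Section Average.
Variable H : obj U.

(** Self-surjections of [H] are encoded as finite functions in order to sum over them. *)
Definition is_epi (f : {ffun H -> H}) : bool :=
  [forall x, [forall y, f (x * y)%g == (f x * f y)%g]] &&
  [forall y, [exists x, f x == y]].

Definition ffun_epi (f : {f : {ffun H -> H} | is_epi f}) : epi H H.
Proof.
exists (val f).
  by case: f => f /= /andP[/forallP fM _] x y; apply/eqP; have /forallP := fM x.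
case: f => f /= /andP[_ /forallP fS] y; have /existsP[x /eqP xy] := fS y.
by exists x.
Defined.

Lemma is_epi_comp (b : epi H H) (f : {f : {ffun H -> H} | is_epi f}) :
  is_epi [ffun x => val f (b x)].
Proof.
apply/andP; split; apply/forallP => x.
  by apply/forallP => y; rewrite !ffunE epiM; apply/eqP/(epiM (ffun_epi f)).
have [y xE] := epi_surj (ffun_epi f) x; have [z yE] := epi_surj b y.
by apply/existsP; exists z; rewrite !ffunE yE -xE.
Qed.

Definition ffun_epi_comp b f : {f : {ffun H -> H} | is_epi f} :=
  Sub _ (is_epi_comp b f).

Lemma ffun_epi_comp_inj b : injective (ffun_epi_comp b).
Proof.
move=> f g /(congr1 val)/ffunP fg; apply/val_inj/ffunP => x.
by have [y <-] := epi_surj b x; have := fg y; rewrite !ffunE.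
Qed.

Definition average M (m : M H) : M H :=
  #|{: {f | is_epi f}}|%:R^-1 *: \sum_f fmap M (ffun_epi f) m.

(** Precomposition with the surjection [b] is injective on the finite set of self-surjections, so it
    merely reindexes the sum. *)
Lemma average_invariant M (m : M H) : invariant (average m).
Proof.
move=> b; rewrite linearZ linear_sum; congr (_ *: _).
rewrite [RHS](reindex_inj (@ffun_epi_comp_inj b)); apply: eq_bigr => f _.
rewrite -[LHS](fmap_comp (ffun_epi f) b).
by apply: eq_fmap => x; rewrite /= ffunE.
Qed.

Lemma average_nt M N (f : nat_trans M N) (m : M H) :
  f H (average m) = average (f H m).
Proof.
by rewrite linearZ linear_sum; congr (_ *: _); apply: eq_bigr => g _; rewrite nt_nat.
Qed.

Lemma averageD M (m m' : M H) : average (m + m') = average m + average m'.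
Proof.
rewrite -scalerDr -big_split; congr (_ *: _).
by apply: eq_bigr => f _; rewrite linearD.
Qed.

Lemma averageN M (m : M H) : average (- m) = - average m.
Proof.
by rewrite -scalerN -sumrN; congr (_ *: _); apply: eq_bigr => f _; rewrite linearN.
Qed.

Hypothesis k_char0 : [pchar k] =i pred0.

(** The set of self-surjections contains the identity, so its cardinality is invertible in
    characteristic zero. *)
Lemma average_id M (m : M H) : invariant m -> average m = m.
Proof.
move=> im; rewrite /average (eq_bigr (fun=> m)) // sumr_const.
rewrite -scaler_nat scalerA mulVf ?scale1r //.
rewrite (pcharf0P k).1 // -lt0n; apply/card_gt0P.
have id_epi : is_epi [ffun x => x].
  apply/andP; split; apply/forallP => x.
    by apply/forallP => y; rewrite !ffunE.
  by apply/existsP; exists x; rewrite ffunE.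
by exists (Sub _ id_epi).
Qed.

End Average.

(** ** The projective generator attached to a group *)

Section Cells.
Variables (H : obj U) (q : int).

(* The kernels of epimorphisms [G -> H] are the orbits of [Aut H] on these, so
   that they form a basis of [k[Hom(G, H)]_(Aut H)].  There are cells in degree
   [q] only: making the degree part of the condition puts this module in degree
   [q] without a case distinction on types. *)
Definition cell (n : int) (G : obj U) : finType :=
  {K : {set G} | (n == q) && `[< exists f : epi G H, K = ker_set f >]}.

Lemma cell_epi_ex n G (K : cell n G) : exists f : epi G H, val K = ker_set f.
Proof. by case: K => K /= /andP[_ /asboolP]. Qed.

Definition cell_epi n G (K : cell n G) : epi G H := projT1 (cid (cell_epi_ex K)).

Lemma cell_epiE n G (K : cell n G) : ker_set (cell_epi K) = val K.
Proof. by rewrite /cell_epi; case: cid. Qed.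

Lemma cell_deg n G (K : cell n G) : n = q.
Proof. by case: K => K /= /andP[/eqP]. Qed.

Lemma epi_cell_subproof n (G : obj U) (f : epi G H) : n = q ->
  (n == q) && `[< exists g : epi G H, ker_set f = ker_set g >].
Proof. by move=> ->; rewrite eqxx; apply/asboolP; exists f. Qed.

Definition epi_cell n (G : obj U) (f : epi G H) (e : n = q) : cell n G :=
  exist _ (ker_set f) (epi_cell_subproof f e).

Definition cell_pull n (G G' : obj U) (e : epi G G') (K : cell n G') : cell n G :=
  epi_cell (epi_comp (cell_epi K) e) (cell_deg K).

Definition cell_mod n G : lmodType k := {ffun cell n G -> k^o}.

Definition delta n G (K : cell n G) : cell_mod n G := [ffun L => (L == K)%:R].

Definition cell_lin n G (V : lmodType k) (F : cell n G -> V) (p : cell_mod n G) : V :=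
  \sum_K p K *: F K.

Lemma cell_lin_linear n G (V : lmodType k) (F : cell n G -> V) : linear (cell_lin F).
Proof.
move=> a x y; rewrite /cell_lin scaler_sumr -big_split; apply: eq_bigr => K _.
by rewrite !ffunE scalerDl scalerA.
Qed.

Lemma cell_lin_delta n G (V : lmodType k) (F : cell n G -> V) K :
  cell_lin F (delta K) = F K.
Proof.
rewrite /cell_lin (bigD1 K) //= ffunE eqxx scale1r big1 ?addr0 // => L.
by rewrite ffunE => /negbTE ->; rewrite scale0r.
Qed.

Lemma cell_modE n G (p : cell_mod n G) : p = cell_lin (@delta n G) p.
Proof.
apply/ffunP => K; rewrite sum_ffunE (bigD1 K) // big1 => [|L]; last first.
  by rewrite !ffunE eq_sym => /negbTE ->; apply: scaler0.
by rewrite !ffunE eqxx; apply/esym; rewrite [LHS]addr0; apply: mulr1.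
Qed.

Lemma cell_lin_ext n G (V : lmodType k) (f : {linear cell_mod n G -> V})
    (F : cell n G -> V) (p : cell_mod n G) :
  (forall K, f (delta K) = F K) -> f p = cell_lin F p.
Proof.
move=> fF; rewrite {1}[p]cell_modE linear_sum; apply: eq_bigr => K _.
by rewrite linearZ /= fF.
Qed.

Lemma eq_cell_lin n G (V : lmodType k) (F F' : cell n G -> V) (p : cell_mod n G) :
  F =1 F' -> cell_lin F p = cell_lin F' p.
Proof. by move=> FF'; apply: eq_bigr => K _; rewrite FF'. Qed.

Definition cell_fmap n (G G' : obj U) (e : epi G G') :
    {linear cell_mod n G' -> cell_mod n G} :=
  linfun_of (cell_lin_linear (fun K => delta (cell_pull e K))).

Lemma cell_fmap_delta n (G G' : obj U) (e : epi G G') (K : cell n G') :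
  cell_fmap n e (delta K) = delta (cell_pull e K).
Proof. exact: cell_lin_delta. Qed.

Lemma mem_cell_pull n (G G' : obj U) (e : epi G G') (K : cell n G') x :
  (x \in val (cell_pull e K)) = (e x \in val K).
Proof. by rewrite -[in RHS]cell_epiE !inE. Qed.

(** A conjugate of an element is trivial only if the element is, so conjugate surjections pull a
    kernel back to the same subgroup. *)
Lemma cell_fmap_conj n (G G' : obj U) (e f : epi G G') :
  epi_conj e f -> cell_fmap n e =1 cell_fmap n f.
Proof.
move=> [h ef] p; apply: eq_cell_lin => K; congr delta.
apply/val_inj/setP => x; rewrite !mem_cell_pull ef -cell_epiE !inE.
by rewrite epiJ conjg_eq1.
Qed.

Lemma cell_fmap_id n (G : obj U) : cell_fmap n (epi_id G) =1 id.
Proof.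
move=> p; rewrite [RHS]cell_modE; apply: eq_cell_lin => K; congr delta.
by apply/val_inj/setP => x; rewrite mem_cell_pull.
Qed.

Lemma cell_fmap_comp n (G G' K : obj U) (g : epi G' K) (f : epi G G') :
  cell_fmap n (epi_comp g f) =1 cell_fmap n f \o cell_fmap n g.
Proof.
move=> p; apply/esym; apply: cell_lin_ext => L.
rewrite -[LHS]/(cell_fmap n f (cell_fmap n g (delta L))) !cell_fmap_delta.
by congr delta; apply/val_inj/setP => x; rewrite !mem_cell_pull.
Qed.

Definition cells n : functor k U :=
  @Functor k U (cell_mod n) (cell_fmap n) (@cell_fmap_conj n) (@cell_fmap_id n)
    (@cell_fmap_comp n).

(** The Yoneda map: an invariant [m] determines the transformation that sends the generator to
    [m]. *)
Definition cell_map M (m : M H) n G (p : cells n G) : M G :=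
  cell_lin (fun K => fmap M (cell_epi K) m) p.

Lemma cell_map_linear M (m : M H) n G : linear (@cell_map M m n G).
Proof. exact: cell_lin_linear. Qed.

(** The epimorphism chosen for a pulled back kernel may differ from the composite, but both have the
    same kernel, and an invariant [m] does not distinguish them. *)
Lemma cell_map_nat M (m : M H) (im : invariant m) n (G G' : obj U) (e : epi G G')
    (p : cells n G') :
  cell_map m (fmap (cells n) e p) = fmap M e (cell_map m p).
Proof.
rewrite /cell_map linear_sum.
pose f : {linear cell_mod n G' -> M G} :=
  linfun_of (cell_map_linear m (n := n) (G := G)) \o cell_fmap n e.
rewrite -[LHS]/(f p) (cell_lin_ext (F := fun K => fmap M e (fmap M (cell_epi K) m))).
  by apply: eq_bigr => K _; rewrite linearZ.
move=> K; rewrite -[LHS]/(cell_map m (cell_fmap n e (delta K))).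
rewrite cell_fmap_delta [LHS]cell_lin_delta.
rewrite -[RHS](fmap_comp (cell_epi K) e); apply: invariant_ker => //.
by rewrite cell_epiE.
Qed.

Lemma nt_cell_map M N (f : nat_trans M N) (m : M H) n G (p : cells n G) :
  f G (cell_map m p) = cell_map (f H m) p.
Proof.
by rewrite linear_sum; apply: eq_bigr => K _; rewrite linearZ /= nt_nat.
Qed.

Lemma cell_mapD M (m m' : M H) n G (p : cells n G) :
  cell_map (m + m') p = cell_map m p + cell_map m' p.
Proof.
by rewrite -big_split; apply: eq_bigr => K _; rewrite linearD scalerDr.
Qed.

Lemma cell_mapN M (m : M H) n G (p : cells n G) : cell_map (- m) p = - cell_map m p.
Proof. by rewrite -sumrN; apply: eq_bigr => K _; rewrite linearN scalerN. Qed.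

Lemma cell_map0 M n G (p : cells n G) : cell_map (0 : M H) p = 0.
Proof. by rewrite [LHS]big1 // => K _; rewrite linear0 scaler0. Qed.

Lemma cell_map_r0 M (m : M H) n G : cell_map m (0 : cells n G) = 0.
Proof. by rewrite [LHS]big1 // => K _; rewrite ffunE scale0r. Qed.

Lemma cells_deg n G (p : cells n G) : n != q -> p = 0.
Proof. by move=> nq; apply/ffunP => K; rewrite (cell_deg K) eqxx in nq. Qed.

Lemma cells_no_epi n G (p : cells n G) : ~ inhabited (epi G H) -> p = 0.
Proof. by move=> nf; apply/ffunP => K; case: nf; exact: (inhabits (cell_epi K)). Qed.

Definition gen : cells q H := delta (epi_cell (epi_id H) erefl).

Lemma gen_neq0 : gen <> 0.
Proof.
move/ffunP/(_ (epi_cell (epi_id H) erefl))/eqP.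
by rewrite !ffunE eqxx oner_eq0.
Qed.

(** Self-surjections of [H] are injective by counting, so at [H] the functor is spanned by a single
    cell. *)
Lemma cell_self n (K : cell n H) : val K = [set 1%g].
Proof.
rewrite -cell_epiE; apply/setP => x; rewrite !inE -{1}(epi1 (cell_epi K)).
by rewrite (inj_eq (epi_inj (leqnn _))).
Qed.

Lemma cells_self (p : cells q H) : p = p (epi_cell (epi_id H) erefl) *: gen.
Proof.
have one (K : cell q H) : K = epi_cell (epi_id H) erefl.
  by apply: val_inj; rewrite !cell_self.
apply/ffunP => K; rewrite !ffunE [K]one eqxx.
by rewrite /GRing.scale /= mulr1.
Qed.

Lemma gen_invariant : invariant (M := cells q) gen.
Proof.
move=> b; rewrite [LHS]cell_fmap_delta; congr delta.
by apply: val_inj; rewrite !cell_self.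
Qed.

Lemma cell_map_gen M (m : M H) : invariant m -> cell_map m gen = m.
Proof.
move=> im; rewrite [LHS]cell_lin_delta -[RHS](fmap_id); apply: invariant_ker => //.
by rewrite cell_epiE.
Qed.

Lemma gen_cell_map G (p : cells q G) : cell_map gen p = p.
Proof.
rewrite [RHS]cell_modE; apply: eq_cell_lin => K; rewrite [LHS]cell_fmap_delta.
congr delta; apply/val_inj/setP => x.
by rewrite mem_cell_pull cell_self -[in RHS]cell_epiE !inE.
Qed.

End Cells.
End FunctorTheory.

(** * Attaching cells to a complex *)

Section Attach.
Variables (k : fieldType) (U : finGroupType -> Prop).
Implicit Types A Z W : cx k U.

Section CopairNt.
Variables (H : obj U) (q n : int) (M N : functor k U).
Variables (f : nat_trans M N) (m : N H) (im : invariant m).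

Lemma copair_linear G :
  linear (fun x : prod_functor M (cells k H q n) G => f G x.1 + cell_map m x.2).
Proof. by move=> a x y; rewrite linearP cell_map_linear scalerDr addrACA. Qed.

Lemma copair_nat (G G' : obj U) (e : epi G G')
    (x : prod_functor M (cells k H q n) G') :
  f G (fmap (prod_functor M (cells k H q n)) e x).1 +
    cell_map m (fmap (prod_functor M (cells k H q n)) e x).2 =
  fmap N e (f G' x.1 + cell_map m x.2).
Proof. by rewrite linearD -nt_nat -cell_map_nat. Qed.

Definition copair_nt : nat_trans (prod_functor M (cells k H q n)) N :=
  mk_nt copair_linear copair_nat.
End CopairNt.

Section AttachDef.
Variables (A : cx k U) (H : obj U) (q : int) (a : A q H).
Hypotheses (ia : invariant a) (ca : is_closed a).

(** Underlying functors of the mapping cone of the map to [A] sending the generator to [a]; the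
    cells lie one degree above [a]. *)
Definition attach_ob n : functor k U := prod_functor (A n) (cells k H (q + 1) n).

(** [deg_cast] makes the attaching element [a] in degree [q] and 0 elsewhere, so one formula covers
    all degrees. *)
Let copair_d n m := copair_nt (q + 1) n (cd A n m) (invariant_nt (deg_cast A q m) ia).

Lemma attach_d_linear n m G :
  linear (fun x : attach_ob n G => (copair_d n m G x, 0) : attach_ob m G).
Proof. by move=> b x y; rewrite linearP; congr (_, _); rewrite /= scaler0 addr0. Qed.

Lemma attach_d_nat n m (G G' : obj U) (e : epi G G') (x : attach_ob n G') :
  (copair_d n m G (fmap (attach_ob n) e x), 0) =
  fmap (attach_ob m) e ((copair_d n m G' x, 0) : attach_ob m G').
Proof. by rewrite nt_nat /= /prod_fmap linear0. Qed.

Definition attach_d n m : nat_trans (attach_ob n) (attach_ob m) :=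
  mk_nt (@attach_d_linear n m) (@attach_d_nat n m).

Lemma attach_dE n m G (x : attach_ob n G) :
  attach_d n m G x = (cd A n m G x.1 + cell_map (deg_cast A q m H a) x.2, 0).
Proof. by []. Qed.

Lemma attach_shape (n m : int) (G : obj U) (x : attach_ob n G) :
  n != m + 1 -> attach_d n m G x = 0.
Proof.
move=> nm; rewrite attach_dE cd_shape // add0r.
have [nq|/eqP nq] := pselect (n = q + 1); last by rewrite (cells_deg x.2 nq) cell_map_r0.
rewrite deg_cast_ne ?cell_map0 //; apply: contra nm => /eqP <-.
exact/eqP.
Qed.

Lemma attach_d2 (n m p : int) (G : obj U) (x : attach_ob n G) :
  attach_d m p G (attach_d n m G x) = 0.
Proof.
rewrite !attach_dE /= cell_map_r0 linearD cd2 nt_cell_map addr0 add0r.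
by rewrite (closed_deg_cast _ ca) cell_map0.
Qed.

Definition attach : cx k U := Cx attach_shape attach_d2.

Lemma attach_in_linear n G : linear (fun x : A n G => (x, 0) : attach n G).
Proof. by move=> b x y; congr (_, _); rewrite /= scaler0 addr0. Qed.

Lemma attach_in_nat n (G G' : obj U) (e : epi G G') (x : A n G') :
  (fmap (A n) e x, 0) = fmap (attach n) e ((x, 0) : attach n G').
Proof. by rewrite /= /prod_fmap linear0. Qed.

Lemma attach_in_comm (n m : int) (G : obj U) (x : A n G) :
  mk_nt (@attach_in_linear m) (@attach_in_nat m) G (cd A n m G x) =
  cd attach n m G (mk_nt (@attach_in_linear n) (@attach_in_nat n) G x).
Proof. by rewrite [RHS]attach_dE /= cell_map_r0 addr0. Qed.

Definition attach_in : chmap A attach :=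
  @Chmap k U A attach (fun n => mk_nt (@attach_in_linear n) (@attach_in_nat n))
    attach_in_comm.

Section AttachMap.
Variables (Z : cx k U) (f : chmap A Z) (z : Z (q + 1) H).
Hypotheses (iz : invariant z) (dz : cd Z (q + 1) q H z = f q H a).

Let attach_map_nt n : nat_trans (attach n) (Z n) :=
  copair_nt (q + 1) n (f n) (invariant_nt (deg_cast Z (q + 1) n) iz).

Lemma attach_map_comm (n m : int) (G : obj U) (x : attach n G) :
  attach_map_nt m G (cd attach n m G x) = cd Z n m G (attach_map_nt n G x).
Proof.
have [nm|nm] := eqVneq n (m + 1); last by rewrite !(cd_shape _ nm) linear0.
rewrite /= cell_map_r0 addr0 !linearD -ch_comm !nt_cell_map; congr (_ + _).
have [nq|/eqP nq] := pselect (n = q + 1); last by rewrite (cells_deg x.2 nq) !cell_map_r0.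
have mq : m = q by apply: (addIr 1); rewrite -nm.
by subst m; move: x; rewrite nq => x; rewrite !deg_cast_id dz.
Qed.

(** To extend [f] over the cell is to choose an invariant chain [z] bounding the image of [a]. *)
Definition attach_map : chmap attach Z :=
  @Chmap k U attach Z attach_map_nt attach_map_comm.

Lemma attach_mapE n G (x : attach n G) :
  attach_map n G x = f n G x.1 + cell_map (deg_cast Z (q + 1) n H z) x.2.
Proof. by []. Qed.
End AttachMap.

Definition attach_gen : attach (q + 1) H := (0, gen k H (q + 1)).

Lemma attach_gen_linear n G :
  linear (fun c : cells k H (q + 1) n G => (0, c) : attach n G).
Proof. by move=> b x y; congr (_, _); rewrite /= scaler0 addr0. Qed.

Lemma attach_gen_nat n (G G' : obj U) (e : epi G G') (c : cells k H (q + 1) n G') :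
  (0, fmap (cells k H (q + 1) n) e c) = fmap (attach n) e ((0, c) : attach n G').
Proof. by rewrite /= /prod_fmap linear0. Qed.

Lemma attach_genE G (c : cells k H (q + 1) (q + 1) G) :
  (0, c) = cell_map attach_gen c :> attach (q + 1) G.
Proof.
rewrite -[in LHS](gen_cell_map c).
exact: (nt_cell_map (mk_nt (@attach_gen_linear (q + 1)) (@attach_gen_nat (q + 1)))).
Qed.

Lemma attach_gen_invariant : invariant attach_gen.
Proof.
by move=> b; rewrite /= /prod_fmap /attach_gen /= linear0 [X in (_, X)]gen_invariant.
Qed.

Lemma d_attach_gen : cd attach (q + 1) q H attach_gen = attach_in q H a.
Proof.
rewrite [LHS]attach_dE /= linear0 add0r deg_cast_id.
by rewrite (cell_map_gen _ ia).
Qed.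

Lemma attach_map_in (Z : cx k U) (f : chmap A Z) (z : Z (q + 1) H)
    (iz : invariant z) (dz : cd Z (q + 1) q H z = f q H a) n G (x : A n G) :
  attach_map iz dz n G (attach_in n G x) = f n G x.
Proof. by rewrite attach_mapE /= cell_map_r0 addr0. Qed.

Lemma attach_map_gen (Z : cx k U) (f : chmap A Z) (z : Z (q + 1) H)
    (iz : invariant z) (dz : cd Z (q + 1) q H z = f q H a) :
  attach_map iz dz (q + 1) H attach_gen = z.
Proof. by rewrite attach_mapE /= linear0 add0r deg_cast_id (cell_map_gen _ iz). Qed.

(** A homotopy out of the attached complex consists of one on [A] together with its invariant value
    [s] on the generator. *)
Lemma attach_homotopic (Z : cx k U) (f g : chmap attach Z)
    (h : forall n m, nat_trans (A n) (Z m)) (s : Z (q + 1 + 1) H) :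
  invariant s ->
  (forall n p m G (x : A n G), n = m + 1 -> p = n + 1 ->
     f n G (attach_in n G x) - g n G (attach_in n G x) =
     cd Z p n G (h n p G x) + h m n G (cd A n m G x)) ->
  f (q + 1) H attach_gen - g (q + 1) H attach_gen =
    cd Z (q + 1 + 1) (q + 1) H s + h q (q + 1) H a ->
  homotopic f g.
Proof.
move=> is_ hA hgen; apply/homotopicP.
exists (fun n m => copair_nt (q + 1) n (h n m)
          (invariant_nt (deg_cast Z (q + 1 + 1) m) is_)).
move=> n p m G [x c] nm pn.
have -> : (x, c) = attach_in n G x + ((0, c) : attach n G).
  by congr (_, _); rewrite /= ?addr0 ?add0r.
rewrite !linearD addrACA (hA _ _ _ _ _ nm pn) /=.
rewrite !linear0 !cell_map_r0 !addr0 !add0r [RHS]addrACA; congr (_ + _).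
have [nq|/eqP nq] := pselect (n = q + 1); last first.
  have -> : (0, c) = 0 :> attach n G by rewrite (cells_deg c nq).
  by rewrite (cells_deg c nq) !cell_map_r0 !linear0 ?subrr ?addr0.
have mq : m = q by apply: (addIr 1); rewrite -nm.
subst n; subst m; subst p.
rewrite /= nt_cell_map !deg_cast_id nt_cell_map -cell_mapD -hgen.
rewrite attach_genE.
by rewrite !nt_cell_map -cell_mapN -cell_mapD.
Qed.

End AttachDef.

(** * Comparing two attachments along a quasi-isomorphism *)

Section AttachQuasiIso.
Variables (A W : cx k U) (H : obj U) (q : int) (a : A q H) (w : W q H).
Hypotheses (ia : invariant a) (ca : is_closed a) (iw : invariant w) (cw : is_closed w).
Variables (f : chmap W A) (a1 : A (q + 1) H).
Hypotheses (ia1 : invariant a1) (da1 : cd A (q + 1) q H a1 = f q H w - a).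

(** Since [f w] is [a] plus the boundary of [a1], adding [a1] to the generator gives a chain
    bounding [f w]. *)
Let z := attach_gen ia ca + attach_in ia ca (q + 1) H a1.

Lemma attach_cmp_invariant : invariant z.
Proof.
apply: invariantD; first exact: attach_gen_invariant.
exact: (invariant_nt (attach_in ia ca (q + 1)) ia1).
Qed.

Lemma attach_cmp_d :
  cd (attach ia ca) (q + 1) q H z = ch_comp (attach_in ia ca) f q H w.
Proof. by rewrite linearD d_attach_gen -ch_comm -linearD da1 addrC subrK. Qed.

Definition attach_cmp : chmap (attach iw cw) (attach ia ca) :=
  attach_map iw cw attach_cmp_invariant attach_cmp_d.

Lemma attach_cmpE n G (x : attach iw cw n G) :
  attach_cmp n G x = (f n G x.1 + cell_map (deg_cast A (q + 1) n H a1) x.2, x.2).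
Proof.
rewrite [LHS]attach_mapE.
have [nq|/eqP nq] := pselect (n = q + 1); last first.
  by rewrite (cells_deg x.2 nq) !cell_map_r0 !addr0.
subst n; rewrite !deg_cast_id cell_mapD -nt_cell_map -attach_genE.
by congr (_, _); rewrite /= ?add0r ?addr0.
Qed.

Lemma attach_cell_d n m G (c : cells k H (q + 1) n G) : n = m + 1 ->
  f m G (cell_map (deg_cast W q m H w) c) =
  cell_map (deg_cast A q m H a) c +
  cd A n m G (cell_map (deg_cast A (q + 1) n H a1) c).
Proof.
move=> nm; have [nq|/eqP nq] := pselect (n = q + 1); last first.
  by rewrite (cells_deg c nq) !cell_map_r0 !linear0 addr0.
have mq : m = q by apply: (addIr 1); rewrite -nm.
subst n; subst m; rewrite !deg_cast_id !nt_cell_map -cell_mapD da1.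
by rewrite [a + _]addrC subrK.
Qed.

(** The five lemma, on elements: both sides extend the same cells, one by [W] and the other by
    [A]. *)
Lemma attach_quasi_iso : quasi_iso f -> quasi_iso attach_cmp.
Proof.
move=> /quasi_isoP qf; apply/quasi_isoP => n G; have [inj sur] := qf n G; split.
  move=> [x c] cx /exact_lift[[y c']].
  rewrite attach_dE attach_cmpE /= => -[e c0]; subst c.
  have {}cx : is_closed x.
    by move=> m; have := cx m; rewrite attach_dE /= cell_map_r0 addr0 => -[].
  rewrite cell_map_r0 addr0 in e.
  (* After subtracting the boundary of the cell part, the image of [x] bounds in [A], so the
     difference bounds in [W]. *)
  have [y' y'E] : exists y', cd W (n + 1) n G y' = x - cell_map (deg_cast W q n H w) c'.
    apply: exact_lift; apply: inj.
      apply: closedB => // m; rewrite nt_cell_map (closed_deg_cast _ cw).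
      exact: cell_map0.
    rewrite linearB (attach_cell_d c' erefl) -e.
    exists (n + 1), (y - cell_map (deg_cast A (q + 1) (n + 1) H a1) c').
    by rewrite linearB; zmod.
  exists (n + 1), (y', c'); rewrite attach_dE /= y'E subrK.
  by [].
move=> [y c] cy; have [m nm] : exists m, n = m + 1 by exists (n - 1); rewrite subrK.
(* The attaching cycle of [c] bounds in [W] because its image bounds in [A]; this completes [c] to a
   cycle. *)
subst n; have [x' x'E] :
    exists x', cd W (m + 1) m G x' = - cell_map (deg_cast W q m H w) c.
  apply/exact_lift/exactN; have [jnj _] := qf m G; apply: jnj.
    by move=> p; rewrite nt_cell_map (closed_deg_cast _ cw) cell_map0.
  rewrite (attach_cell_d c erefl).
  have := cy m; rewrite attach_dE /= => -[/eqP].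
  rewrite addr_eq0 eq_sym eqr_oppLR => /eqP ->.
  by apply: exactD; [apply: exactN|]; apply: exact_d.
have cx : is_closed ((x', c) : attach iw cw (m + 1) G).
  move=> p; have [mp|mp] := eqVneq (m + 1) (p + 1); last exact: cd_shape.
  by move/addIr: mp => <-; rewrite attach_dE /= x'E addNr.
(* The lift misses [(y, c)] by a cycle [r] of [A], whose class lifts along [f]. *)
pose r := f _ G x' + cell_map (deg_cast A (q + 1) (m + 1) H a1) c - y.
have cr : is_closed r.
  move=> p; have := closedB (closed_ch attach_cmp cx) cy p.
  by rewrite attach_cmpE attach_dE /= subrr cell_map_r0 addr0 => -[].
have [r' cr' er] := sur r cr.
have cr'' : is_closed ((r', 0) : attach iw cw (m + 1) G).
  by move=> p; rewrite attach_dE /= cr' cell_map_r0 addr0.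
exists ((x', c) - (r', 0)); first exact: closedB.
have -> : attach_cmp (m + 1) G ((x', c) - (r', 0)) - (y, c) =
    attach_in ia ca _ G (- (f _ G r' - r)).
  by rewrite attach_cmpE; congr (_, _); rewrite /= ?subr0 ?subrr // linearB /r; zmod.
exact/exact_ch/exactN.
Qed.
End AttachQuasiIso.

End Attach.

(** * Attaching a cell preserves compactness *)

Section AttachCompact.
Variables (k : fieldType) (U : finGroupType -> Prop).
Hypothesis k_char0 : [pchar k] =i pred0.
Variables (A : cx k U) (H : obj U) (q : int) (a : A q H).
Hypotheses (ia : invariant a) (ca : is_closed a).

(* Characteristic zero enters here: classes of invariant cycles lift to
   invariant cycles by averaging. *)
Lemma invariant_lift (W : cx k U) (f : chmap W A) : quasi_iso f ->
  exists (w : W q H) (a1 : A (q + 1) H),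
    [/\ invariant w, is_closed w, invariant a1 &
        cd A (q + 1) q H a1 = f q H w - a].
Proof.
move=> /quasi_isoP /(_ q H)[_ /(_ a ca)[w cw /exact_lift[a1 da1]]].
exists (average w), (average a1); split; try exact: average_invariant.
  by move=> m; rewrite average_nt cw average_id //; apply: invariant0.
rewrite !average_nt da1 averageD averageN (average_id k_char0 ia).
by [].
Qed.

Lemma attach_finitely_factoring :
  finitely_factoring A -> finitely_factoring (attach ia ca).
Proof.
move=> fA I Y S inj injP Z t g qt.
(* The fraction is restricted to [A], where the hypothesis on [A] truncates its numerator to a
   finite set [s]. *)
have [V [alpha [beta [qalpha h0]]]] := ore_square (attach_in ia ca) qt.
have [W [v [s [qv us h1]]]] := fA I Y S inj injP V alpha (ch_comp g beta) qalpha.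
pose f := ch_comp alpha v; pose b := ch_comp beta v.
have qf : quasi_iso f by apply: quasi_iso_comp.
have [eta etaP] : exists eta : forall n m, nat_trans (W n) (attach ia ca m),
    forall n p m G (x : W n G), n = m + 1 -> p = n + 1 ->
    attach_in ia ca n G (f n G x) - t n G (b n G x) =
    cd (attach ia ca) p n G (eta n p G x) + eta m n G (cd W n m G x).
  exact: (proj1 (homotopicP _ _) (homotopic_compr v h0)).
have [h hP] : exists h : forall n m, nat_trans (W n) (S m),
    forall n p m G (x : W n G), n = m + 1 -> p = n + 1 ->
    g n G (b n G x) - trunc injP s n G (g n G (b n G x)) =
    cd S p n G (h n p G x) + h m n G (cd W n m G x).
  exact: (proj1 (homotopicP _ _) h1).
have [w [a1 [iw cw ia1 da1]]] := invariant_lift qf.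
pose e := attach_gen ia ca + attach_in ia ca (q + 1) H a1.
(* Subtracting the homotopy [eta] turns a chain bounding [f w] into one bounding [t (b w)]. *)
pose u := e - eta q (q + 1) H w.
have eta_w : cd (attach ia ca) (q + 1) q H (eta q (q + 1) H w) =
    attach_in ia ca q H (f q H w) - t q H (b q H w).
  by rewrite (etaP q (q + 1) (q - 1)) ?subrK // cw linear0 addr0.
have du : cd (attach ia ca) (q + 1) q H u = t q H (b q H w).
  by rewrite linearB (attach_cmp_d ia ca da1) eta_w /=; zmod.
have iu : invariant u.
  apply: invariantD; first exact: attach_cmp_invariant.
  by apply: invariantN; apply: (invariant_nt (eta q (q + 1)) iw).
(* As [t] is a quasi-isomorphism, [b w] bounds some [z'], and a cycle [z''] corrects it so that its
   image is homologous to [u]; averaging then makes everything invariant. *)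
have [z [c2 [iz ic2 dz tz]]] : exists (z : Z (q + 1) H)
    (c2 : attach ia ca (q + 1 + 1) H),
    [/\ invariant z, invariant c2, cd Z (q + 1) q H z = b q H w &
        t (q + 1) H z = u - cd (attach ia ca) (q + 1 + 1) (q + 1) H c2].
  move/quasi_isoP: (qt) => qtP.
  have [z' dz'] : exists z', cd Z (q + 1) q H z' = b q H w.
    apply: exact_lift; apply: (proj1 (qtP q H)); first exact: closed_ch.
    by rewrite -du; apply: exact_d.
  have [|z'' cz'' /exact_lift[c2 dc2]] := proj2 (qtP (q + 1) H) (t (q + 1) H z' - u).
    move=> m; have [->|qm] := eqVneq m q.
      by rewrite linearB du -ch_comm dz' subrr.
    by rewrite cd_shape //; apply: contra qm => /eqP/addIr ->.
  exists (average (z' - z'')), (average c2); split; try exact: average_invariant.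
    by rewrite average_nt linearB dz' cz'' subr0 average_id //; apply: invariant_nt.
  rewrite average_nt average_nt dc2 linearB.
  rewrite -{1}(average_id k_char0 iu) -averageN -averageD.
  by congr average; zmod.
pose gamma := attach_map iw cw iz dz.
have gamma_in n G x : gamma n G (attach_in iw cw n G x) = b n G x.
  exact: attach_map_in.
have gamma_gen : gamma (q + 1) H (attach_gen iw cw) = z by apply: attach_map_gen.
(* [t] after [gamma] is homotopic to the comparison map of the two attachments, with [eta] on [W]
   and [c2] on the cell. *)
have qgamma : quasi_iso gamma.
  apply: (quasi_iso_cancell qt).
  apply: quasi_iso_homotopic (attach_quasi_iso ia ca iw cw ia1 da1 qf).
  apply: (attach_homotopic (h := eta) ic2) => [n p m G x nm pn|].
    rewrite -(etaP n p m G x nm pn) -gamma_in.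
    by congr (_ - _); apply: (attach_map_in iw cw).
  transitivity (e - t (q + 1) H z); last by rewrite tz /u; zmod.
  by rewrite -gamma_gen; congr (_ - _); apply: (attach_map_gen iw cw).
(* [s1] is the obstruction to extending the homotopy [h] over the cell. It is a single element, so
   it lives on finitely many summands [s'], and [r] joins these to [s]. *)
pose s1 := g (q + 1) H z - trunc injP s (q + 1) H (g (q + 1) H z) - h q (q + 1) H w.
have [s' [us' s1P]] := trunc_id injP s1.
pose r := undup (s ++ s').
have ur : uniq r := undup_uniq _.
have sr : {subset s <= r} by move=> i; rewrite mem_undup mem_cat => ->.
have s'r : {subset s' <= r} by move=> i; rewrite mem_undup mem_cat orbC => ->.
exists (attach iw cw), gamma, r; split=> //.
have io : invariant (0 : S (q + 1 + 1) H) by apply: invariant0.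
(* The homotopy is [h] followed by the complement of truncation to [r]. That complement kills [s1],
   so 0 serves as its value on the generator. *)
apply: (attach_homotopic
  (h := fun n m => nt_add (h n m) (nt_opp (nt_comp (trunc injP r m) (h n m)))) io).
- move=> n p m G x nm pn.
  have e1 := congr1 (trunc injP r n G) (hP n p m G x nm pn).
  rewrite linearB (trunc_trunc injP _ us ur sr) [RHS]linearD ch_comm in e1.
  transitivity (g n G (b n G x) - trunc injP r n G (g n G (b n G x))).
    by rewrite -gamma_in.
  transitivity (cd S p n G (h n p G x) + h m n G (cd W n m G x) -
    (cd S p n G (trunc injP r p G (h n p G x)) +
     trunc injP r n G (h m n G (cd W n m G x)))).
    by rewrite -e1 -(hP n p m G x nm pn); zmod.
  by rewrite [RHS]/= [X in _ = X + _]linearB; zmod.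
- transitivity (g (q + 1) H z - trunc injP r (q + 1) H (g (q + 1) H z)).
    by rewrite -gamma_gen.
  have e1 := s1P r ur s'r.
  have e2 : trunc injP r (q + 1) H s1 = trunc injP r (q + 1) H (g (q + 1) H z) -
      trunc injP s (q + 1) H (g (q + 1) H z) -
      trunc injP r (q + 1) H (h q (q + 1) H w).
    by rewrite !linearB (trunc_trunc injP _ us ur sr).
  rewrite /= linear0 add0r; apply/eqP; rewrite -subr_eq0; apply/eqP.
  transitivity (s1 - trunc injP r (q + 1) H s1); last by rewrite e1 subrr.
  by rewrite e2 /s1; zmod.
Qed.

End AttachCompact.

(** * Complexes acyclic at a group *)

Section Acyclic.
Variables (k : fieldType) (U : finGroupType -> Prop) (G : obj U).
Implicit Types X Y Z : cx k U.

Lemma acyclicP X : acyclic_at G X <-> forall n (x : X n G), is_closed x -> is_exact x.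
Proof.
split=> aX n x.
  by move/cycleP/aX/boundaryP.
by move/cycleP/aX/boundaryP.
Qed.

Lemma D_iso_sym X Y : D_iso X Y -> D_iso Y X.
Proof. by move=> [r [s [rs sr]]]; exists s, r. Qed.

(** On homology at [G], the identity of [Y] factors through that of [X], which vanishes. *)
Lemma D_iso_acyclic X Y : D_iso X Y -> acyclic_at G X -> acyclic_at G Y.
Proof.
move=> [r [s [_ [W [u [v [qu [h e]]]]]]]] /acyclicP aX; apply/acyclicP => n y cy.
have [W' [u' [v' [qu' hd hn]]]] := e.
have qv' : quasi_iso v'.
  apply: quasi_iso_homotopic hd _; apply: quasi_iso_comp qu'.
  exact: quasi_iso_comp (den_qi s) qu.
have /quasi_isoP/(_ n G)[_ /(_ y cy)[w cw ew]] := qv'.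
rewrite -[y](subKr (v' n G w)); apply: exactB => //.
rewrite -[v' n G w](subKr (num r n G (v n G (u' n G w)))).
apply: exactB; last exact: (homotopic_exact hn cw).
apply: exact_ch; have /quasi_isoP/(_ n G)[inj _] := den_qi r.
have cvw : is_closed (v n G (u' n G w)) by do 2!apply: closed_ch.
by apply: inj => //; apply: aX; apply: closed_ch.
Qed.

Lemma zero_cx0 n (x : zero_cx k U n G) : x = 0.
Proof.
by move: x; rewrite /= /stalk_ob; case: (n == 0) => /= x; apply: thinmx0.
Qed.

(** The three cases of the long exact homology sequence, by diagram chase. *)
Lemma short_exact_acyclic X Y Z (f : chmap X Y) (g : chmap Y Z) :
  short_exact f g ->
  [/\ acyclic_at G X -> acyclic_at G Y -> acyclic_at G Z,
      acyclic_at G X -> acyclic_at G Z -> acyclic_at G Y &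
      acyclic_at G Y -> acyclic_at G Z -> acyclic_at G X].
Proof.
move=> fg.
have gf n (x : X n G) : g n G (f n G x) = 0.
  by have [_ ex _] := fg n G; apply/ex; exists x.
have kerg n (y : Y n G) : g n G y = 0 -> exists x, f n G x = y.
  by have [_ ex _] := fg n G; move/ex.
have injf n : injective (f n G) by have [] := fg n G.
have surg n (z : Z n G) : exists y, g n G y = z by have [] := fg n G.
have closedf n (x : X n G) : is_closed (f n G x) -> is_closed x.
  by move=> cfx m; apply: injf; rewrite ch_comm cfx linear0.
split=> /acyclicP aX /acyclicP aY; apply/acyclicP => n.
- move=> z cz; have [m nm] : exists m, n = m + 1 by exists (n - 1); rewrite subrK.
  subst n; have [y gy] := surg _ z.
  have [x fx] : exists x, f m G x = cd Y (m + 1) m G y.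
    by apply: kerg; rewrite ch_comm gy.
  have [|x' dx'] := exact_lift (aX m x _).
    by apply: closedf; rewrite fx; apply: closed_d.
  have [|p [y' dy']] := aY _ (y - f _ G x').
    move=> l; have [ml|ml] := eqVneq (m + 1) (l + 1); last exact: cd_shape.
    by move/addIr: ml => <-; rewrite linearB -ch_comm dx' fx subrr.
  by exists p, (g p G y'); rewrite -ch_comm dy' linearB gf subr0.
- move=> y cy; have [z' dz'] := exact_lift (aY n _ (closed_ch g cy)).
  have [y' gy'] := surg _ z'.
  have [x fx] : exists x, f n G x = y - cd Y (n + 1) n G y'.
    by apply: kerg; rewrite linearB ch_comm gy' dz' subrr.
  have cx : is_closed x.
    by apply: closedf; rewrite fx; apply: closedB => //; apply: closed_d.
  rewrite -[y](subrK (cd Y (n + 1) n G y')) -fx.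
  by apply: exactD; [apply/exact_ch/aX | apply: exact_d].
- move=> x cx; have [y dy] := exact_lift (aX n _ (closed_ch f cx)).
  have cgy : is_closed (g _ G y).
    move=> m; rewrite -ch_comm; have [nm|nm] := eqVneq (n + 1) (m + 1).
      by move/addIr: nm => <-; rewrite dy gf.
    by rewrite (cd_shape _ nm) linear0.
  have [z' dz'] := exact_lift (aY _ _ cgy); have [y' gy'] := surg _ z'.
  have [x' fx'] : exists x', f (n + 1) G x' = y - cd Y (n + 1 + 1) (n + 1) G y'.
    by apply: kerg; rewrite linearB ch_comm gy' dz' subrr.
  exists (n + 1), x'; apply: injf.
  by rewrite ch_comm fx' linearB cd2 subr0.
Qed.

Lemma exact_triangle_acyclic X Y Z : exact_triangle X Y Z ->
  [/\ acyclic_at G X -> acyclic_at G Y -> acyclic_at G Z,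
      acyclic_at G X -> acyclic_at G Z -> acyclic_at G Y &
      acyclic_at G Y -> acyclic_at G Z -> acyclic_at G X].
Proof.
move=> [X' [Y' [Z' [f [g [/short_exact_acyclic[aZ aY aX] iX iY iZ]]]]]].
split=> a1 a2; apply: D_iso_acyclic (D_iso_sym _) _; eauto.
- by apply: aZ; [apply: D_iso_acyclic iX _ | apply: D_iso_acyclic iY _].
- by apply: aY; [apply: D_iso_acyclic iX _ | apply: D_iso_acyclic iZ _].
- by apply: aX; [apply: D_iso_acyclic iY _ | apply: D_iso_acyclic iZ _].
Qed.

Lemma coproduct_acyclic (I : choiceType) (Y : I -> cx k U) S
    (inj : forall i, chmap (Y i) S) : is_coproduct inj ->
  acyclic_at G S -> forall i, acyclic_at G (Y i).
Proof.
move=> injP /acyclicP aS i; apply/acyclicP => n y cy.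
have coordK (y' : Y i n G) : ch_coord injP i n G (inj i n G y') = y'.
  (* [dfwith] is the family equal to [y'] at [i] and 0 elsewhere; thus each summand is a retract of
     [S]. *)
  have := @coord_sum _ _ _ _ _ _ injP n G [:: i] (dfwith (fun=> 0) y') i isT.
  by rewrite big_seq1 dfwith_in mem_head.
by rewrite -[y]coordK; apply/exact_ch/aS/closed_ch.
Qed.

(** ** Tensor products *)

Section Tensor.
Variables (X Y Z : cx k U).
Variable b : forall p q n : int, p + q = n ->
  forall G : obj U, X p G -> Y q G -> Z n G.
Hypothesis bP : tensor_structure b.

Lemma tensor_ext n (T : lmodType k) (h h' : {linear Z n G -> T}) :
  (forall p q (e : p + q = n) x y, h (b e x y) = h' (b e x y)) -> h =1 h'.
Proof.
move=> hh'.
have [|h0 [_ h0U]] := tensor_univ bP (T := T)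
    (c := fun p q (e : p + q = n) x y => h (b e (G := G) x y)).
  move=> p q e; have [bl br] := tensor_bilin bP e G; split=> [x|y] a u v.
    by rewrite bl linearP.
  by rewrite br linearP.
by move=> z; rewrite h0U // [RHS]h0U.
Qed.

Lemma tensor0l p q n (e : p + q = n) (y : Y q G) : b e 0 y = 0.
Proof.
have [_ /(_ y) bl] := tensor_bilin bP e G.
exact: (linear0 (linfun_of bl)).
Qed.

Lemma tensor0r p q n (e : p + q = n) (x : X p G) : b e x (0 : Y q G) = 0.
Proof.
have [/(_ x) br _] := tensor_bilin bP e G.
exact: (linear0 (linfun_of br)).
Qed.

Lemma tensorDl p q n (e : p + q = n) (x x' : X p G) (y : Y q G) :
  b e (x + x') y = b e x y + b e x' y.
Proof.
have [_ /(_ y) bl] := tensor_bilin bP e G.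
exact: (linearD (linfun_of bl)).
Qed.

(** Over a field an acyclic complex is contractible: with [t] a pseudo-inverse of the differential
    [d], the contraction is [t (1 - t d)]. *)
Lemma contraction : acyclic_at G X ->
  exists s : forall p l, {linear X p G -> X l G},
  forall (p m l : int) (x : X p G), p = m + 1 -> l = p + 1 ->
    cd X l p G (s p l x) + s m p (cd X p m G x) = x.
Proof.
move=> /acyclicP aX.
pose t p l := projT1 (cid (pseudo_inverse (cd X l p G))).
have tP p l x : cd X l p G (t p l (cd X l p G x)) = cd X l p G x.
  exact: (projT2 (cid (pseudo_inverse (cd X l p G)))).
exists (fun p l => t p l \o (idfun \- (t (p - 1) p \o cd X p (p - 1) G))).
move=> p m l x pm lp; have <- : p - 1 = m by rewrite pm addrK.
rewrite /= cd2 linear0 subr0.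
(* [1 - t d] lands in cycles because [d t d = d]; these are boundaries, on which [d t] is the
   identity. *)
have cz : is_closed (x - t (p - 1) p (cd X p (p - 1) G x)).
  move=> r; have [pr|pr] := eqVneq p (r + 1); last exact: cd_shape.
  have -> : r = p - 1 by rewrite pr addrK.
  by rewrite linearB tP subrr.
by subst l; have /exact_lift[y dy] := aX _ _ cz; rewrite -dy tP dy subrK.
Qed.

(** Tensoring a contraction of [X] with the identity of [Y] contracts [Z]. *)
Lemma tensor_acyclic : acyclic_at G X -> acyclic_at G Z.
Proof.
move=> /contraction[s sP].
have e1 (p q n : int) : p + q = n -> p + 1 + q = n + 1 by move=> <-; rewrite addrAC.
have hE n : exists h : {linear Z n G -> Z (n + 1) G},
    forall p q (e : p + q = n) x y,
      h (b e x y) = b (e1 _ _ _ e) (s p (p + 1) x) y.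
  have [|h [hP _]] := tensor_univ bP (T := Z (n + 1) G)
      (c := fun p q (e : p + q = n) x y => b (e1 _ _ _ e) (s p (p + 1) x) y).
    move=> p q e; have [bl br] := tensor_bilin bP (e1 _ _ _ e) G.
    by split=> [x|y] a u v; rewrite ?bl // linearP br.
  by exists h.
pose h n := projT1 (cid (hE n)).
have hP n p q (e : p + q = n) x y : h n (b e x y) = b (e1 _ _ _ e) (s p (p + 1) x) y.
  exact: (projT2 (cid (hE n))).
have key m : (cd Z (m + 1 + 1) (m + 1) G \o h (m + 1)) \+ (h m \o cd Z (m + 1) m G)
    =1 idfun.
  apply: tensor_ext => p q e x y /=; rewrite hP.
  have [p' pp'] : exists p', p = p' + 1 by exists (p - 1); rewrite subrK.
  have [q' qq'] : exists q', q = q' + 1 by exists (q - 1); rewrite subrK.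
  subst p; subst q.
  have ep : p' + (q' + 1) = m by apply: (addIr 1); rewrite -e addrAC.
  have eq : p' + 1 + q' = m by rewrite -ep addrAC addrA.
  have eq1 : p' + 1 + 1 + q' = m + 1 by rewrite addrAC eq.
  rewrite (tensor_d bP (e1 _ _ _ e) e eq1) // (tensor_d bP e ep eq) //.
  rewrite linearD linearZ /= !hP.
  (* [s] raises the first degree by one, so the two terms with the differential of [Y] have opposite
     signs and cancel. *)
  rewrite expfzDr ?oppr_eq0 ?oner_eq0 // expr1z mulrN1 scaleNr.
  rewrite (eq_irrelevance (e1 _ _ _ eq) eq1) (eq_irrelevance (e1 _ _ _ ep) e).
  by rewrite -[in RHS](sP _ p' (p' + 1 + 1) x) // tensorDl; zmod.
apply/acyclicP => n z cz; pose m := n - 1; have nm : n = m + 1 by rewrite subrK.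
move: z cz; rewrite nm => z cz; exists (m + 1 + 1), (h _ z).
by have := key m z; rewrite /= cz linear0 addr0.
Qed.

(** Composing a functional with [1 - d t], for [t] a pseudo-inverse of the differential [d], makes
    it vanish on boundaries; [x] survives as it is not one. *)
Lemma cycle_functional (C : cx k U) p (x : C p G) : ~ is_exact x ->
  exists phi : {linear C p G -> k^o}, phi x = 1 /\ forall l y, phi (cd C l p G y) = 0.
Proof.
move=> nex; have [t tP] := pseudo_inverse (cd C (p + 1) p G).
have [|phi phix] := @separating_functional k _ (x - cd C (p + 1) p G (t x)).
  apply/eqP => e; apply: nex; exists (p + 1), (t x).
  by apply/eqP; rewrite eq_sym -subr_eq0 e.
exists (phi \o (idfun \- (cd C (p + 1) p G \o t))); split=> // l y.
have [lp|lp] := eqVneq l (p + 1); last by rewrite cd_shape // linear0.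
by subst l; rewrite /= tP subrr linear0.
Qed.

(** The Kuenneth argument: for cycles [x] and [y] that do not bound, a product of functionals kills
    all boundaries of [Z] but takes the value 1 on the tensor of [x] and [y]. *)
Lemma tensor_acyclic_prime : acyclic_at G Z -> acyclic_at G X \/ acyclic_at G Y.
Proof.
move=> /acyclicP aZ; apply: contrapT => /not_orP[nX nY].
have exE (C : cx k U) : ~ acyclic_at G C ->
    exists n (x : C n G), is_closed x /\ ~ is_exact x.
  move=> nC; apply: contrapT => nE; apply/nC/acyclicP => n x cx.
  by apply: contrapT => nx; apply: nE; exists n, x.
have [p [x [clx nx]]] := exE X nX; have [q [y [cly ny]]] := exE Y nY.
have [phi [phix phid]] := cycle_functional nx.
have [psi [psiy psid]] := cycle_functional ny.
have castd (C : cx k U) r (chi : {linear C r G -> k^o}) :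
    (forall l y, chi (cd C l r G y) = 0) ->
    forall l m y, chi (deg_cast C m r G (cd C l m G y)) = 0.
  move=> chid l m y'; have [mr|mr] := eqVneq m r.
    by subst m; rewrite deg_cast_id.
  by rewrite deg_cast_ne // linear0.
(* The casts make the product functional vanish outside bidegree [(p, q)]. *)
have [|h [hE _]] := tensor_univ bP (T := k^o) (c := fun r l (e : r + l = p + q) u v =>
    (phi (deg_cast X r p G u) * psi (deg_cast Y l q G v) : k^o)).
  move=> r l e; split=> [u|v] a u1 u2; rewrite !linearP.
    by rewrite mulrDr /GRing.scale /= mulrCA.
  by rewrite mulrDl /GRing.scale /= mulrA.
have hd z : h (cd Z (p + q + 1) (p + q) G z) = 0.
  have := @tensor_ext _ _ (h \o cd Z (p + q + 1) (p + q) G) \0; apply=> r l e u v /=.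
  have ep : r - 1 + l = p + q by rewrite addrAC e addrK.
  have eq : r + (l - 1) = p + q by rewrite addrA e addrK.
  rewrite (tensor_d bP e ep eq) // linearD linearZ /= !hE !castd //.
  by rewrite mul0r mulr0 scaler0 addr0.
have [z dz] : exists z, cd Z (p + q + 1) (p + q) G z = b (erefl (p + q)) x y.
  apply/exact_lift/aZ => m.
  have [pqm|pqm] := eqVneq (p + q) (m + 1); last exact: cd_shape.
  have ep : p - 1 + q = m by rewrite addrAC pqm addrK.
  have eq : p + (q - 1) = m by rewrite addrA pqm addrK.
  by rewrite (tensor_d bP (erefl _) ep eq) // clx cly tensor0l tensor0r scaler0 addr0.
have := hd z; rewrite dz hE !deg_cast_id phix psiy mulr1 => /eqP.
by rewrite oner_eq0.
Qed.

End Tensor.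
End Acyclic.

(** * The primes attached to the groups *)

Section Primes.
Variables (k : fieldType) (U : finGroupType -> Prop).
Implicit Types G H : obj U.

Lemma isog_acyclic G H (X : cx k U) :
  [set: G] \isog [set: H] -> acyclic_at G X -> acyclic_at H X.
Proof.
case/isog_epi => f [g [fK gK]] /acyclicP aG; apply/acyclicP => n x cx.
have fgx : fmap (X n) g (fmap (X n) f x) = x.
  rewrite -[LHS](fmap_comp f g) -[RHS](fmap_id (f0 := X n)).
  by apply: eq_fmap => y /=; rewrite gK.
have cfx : is_closed (fmap (X n) f x) by move=> m; rewrite nt_nat cx linear0.
have [m [y dy]] := aG _ _ cfx.
by exists m, (fmap (X m) g y); rewrite nt_nat dy fgx.
Qed.

Lemma zero_cx_acyclic G : acyclic_at G (zero_cx k U).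
Proof. by apply/acyclicP => n x _; rewrite (zero_cx0 x); apply: exact0. Qed.

(** Any denominator over the zero complex is refined by the zero complex itself, so the empty sum
    suffices. *)
Lemma zero_cx_finitely_factoring : finitely_factoring (zero_cx k U).
Proof.
move=> I Y S inj injP Z t g qt.
pose w := @Chmap k U (zero_cx k U) Z (fun n => nt_zero _ _)
  (fun n m G x => esym (linear0 _)).
exists (zero_cx k U), w, [::]; split=> //.
  apply: (quasi_iso_cancell qt); apply: quasi_iso_homotopic (quasi_iso_id _).
  by apply: eq_homotopic => n G x; apply: etrans (zero_cx0 _) (esym (zero_cx0 _)).
by apply: eq_homotopic => n G x; rewrite (zero_cx0 x) !linear0.
Qed.

Definition unit_one G : unit_cx k U 0 G := (1 : k^o).

Lemma unit_one_invariant G : invariant (M := unit_cx k U 0) (unit_one G).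
Proof. by []. Qed.

Lemma unit_one_closed G : is_closed (unit_one G).
Proof. by []. Qed.

Lemma unit_cx_deg n G (x : unit_cx k U n G) : n != 0 -> x = 0.
Proof.
by move: x; rewrite /= /stalk_ob; case: (n == 0) => //= x _; apply: thinmx0.
Qed.

Lemma unit_cx_not_acyclic G : ~ acyclic_at G (unit_cx k U).
Proof.
move=> /acyclicP /(_ _ _ (@unit_one_closed G))[m [y /eqP]].
by rewrite eq_sym oner_eq0.
Qed.

Hypothesis k_char0 : [pchar k] =i pred0.
Hypothesis unit_compact : compact (unit_cx k U).

Lemma pideal_prime G : prime_ideal (@pideal k U G).
Proof.
split.
- split.
  + by move=> X iX; apply: D_iso_acyclic (D_iso_sym iX) (@zero_cx_acyclic G).
  + by move=> X Y iXY; apply: D_iso_acyclic.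
  + by move=> A B C; apply: exact_triangle_acyclic.
  + move=> A B C [inj injP] aC.
    have aI := @coproduct_acyclic k U G bool (fun b => if b then A : cx k U else B)
      C inj injP aC.
    by split; [apply: (aI true) | apply: (aI false)].
  + by move=> X Y Z [b bP]; apply: tensor_acyclic bP.
- by exists (Cpt unit_compact); apply: unit_cx_not_acyclic.
- by move=> X Y Z [b bP]; apply: tensor_acyclic_prime bP.
Qed.

(** * The compact objects that separate the primes *)

Section TestObjects.
Variable H : obj U.

Lemma zero_cx_invariant : invariant (0 : zero_cx k U 0 H).
Proof. exact: invariant0. Qed.

Lemma zero_cx_closed : is_closed (0 : zero_cx k U 0 H).
Proof. by move=> m; rewrite linear0. Qed.

(* [k[Hom(-, H)]_(Aut H)] in degree 1. *)
Definition cell_cx : cx k U := attach zero_cx_invariant zero_cx_closed.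

Lemma cell_cx_compact : compact cell_cx.
Proof.
apply/finitely_factoring_compact/attach_finitely_factoring => //.
exact: zero_cx_finitely_factoring.
Qed.

Lemma cell_cx_not_acyclic : ~ acyclic_at H cell_cx.
Proof.
move=> /acyclicP aH.
have [|m [y dy]] := aH _ (attach_gen zero_cx_invariant zero_cx_closed).
  move=> m; rewrite [LHS]attach_dE; congr (_, _); exact: zero_cx0.
(* Differentials have zero cell component, so the generator, a cycle, cannot bound. *)
by apply: (@gen_neq0 k U H (0 + 1)); have := congr1 snd dy.
Qed.

Lemma cell_cx_acyclic G : ~ inhabited (epi G H) -> acyclic_at G cell_cx.
Proof.
move=> nf; apply/acyclicP => n [x c] _.
have -> : (x, c) = 0 :> cell_cx n G.
  by rewrite (cells_no_epi c nf) (zero_cx0 x).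
exact: exact0.
Qed.

(* The cone of the augmentation [k[Hom(-, H)]_(Aut H) -> k]. *)
Definition cone_cx : cx k U :=
  attach (@unit_one_invariant H) (@unit_one_closed H).

Lemma cone_cx_compact : compact cone_cx.
Proof.
apply/finitely_factoring_compact/attach_finitely_factoring => //.
exact: compact_finitely_factoring.
Qed.

Lemma cone_cx_acyclic : acyclic_at H cone_cx.
Proof.
(* At [H] the augmentation sends the one basis element to 1, hence is an isomorphism onto [k]. *)
have mapZ (l : k) : cell_map (q := 1) (deg_cast (unit_cx k U) 0 0 H (unit_one H))
    (l *: gen k H 1) = l.
  have lin1 := @cell_map_linear k U H 1 _ (unit_one H) 1 H.
  rewrite deg_cast_id -[LHS]/(linfun_of lin1 _) linearZ.
  rewrite /= (cell_map_gen _ (@unit_one_invariant H)); exact: mulr1.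
apply/acyclicP => n [x c] clx.
have [n1|/eqP n1] := pselect (n = 0 + 1).
  subst n; have := congr1 fst (clx 0); rewrite attach_dE /= add0r.
  rewrite {1}[c](cells_self c) mapZ => l0.
  have -> : (x, c) = 0 :> cone_cx 1 H.
    by rewrite [c](cells_self c) l0 scale0r (unit_cx_deg x).
  exact: exact0.
have c0 : c = 0 by apply: cells_deg.
have [n0|/eqP n0] := pselect (n = 0).
  subst n; exists 1, (0, (x : k^o) *: gen k H 1).
  by rewrite [LHS]attach_dE c0; congr (_, _); rewrite linear0 add0r [LHS]mapZ.
have -> : (x, c) = 0 :> cone_cx n H by rewrite c0 (unit_cx_deg x n0).
exact: exact0.
Qed.

(** At such a [G] there are no cells, and the cone reduces to the unit, where 1 does not bound. *)
Lemma cone_cx_not_acyclic G : ~ inhabited (epi G H) -> ~ acyclic_at G cone_cx.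
Proof.
move=> nf /acyclicP aG; have [|m [[y c] dy]] := aG 0 (unit_one G, 0).
  by move=> m; rewrite [LHS]attach_dE /= cell_map_r0 addr0.
move: dy; rewrite [LHS]attach_dE /= (cells_no_epi c nf) cell_map_r0 addr0.
move=> -[/eqP]; rewrite eq_sym; apply/negP; exact: oner_neq0.
Qed.

End TestObjects.

Lemma pideal_subset_isog G H :
  (forall X : cpt k U, pideal H X -> pideal G X) -> [set: G] \isog [set: H].
Proof.
move=> HG.
have [[f]|nf] := pselect (inhabited (epi G H)); last first.
  case: (cone_cx_not_acyclic nf).
  exact: (HG (Cpt (cone_cx_compact H)) (@cone_cx_acyclic H)).
have [[g]|ng] := pselect (inhabited (epi H G)); first exact: epi_isog.
case: (@cell_cx_not_acyclic G).
exact: (HG (Cpt (cell_cx_compact G)) (@cell_cx_acyclic G H ng)).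
Qed.

Lemma isog_pideal G H (X : cpt k U) :
  [set: G] \isog [set: H] -> pideal G X <-> pideal H X.
Proof.
by move=> iGH; split; apply: isog_acyclic; rewrite // isog_sym.
Qed.

End Primes.

Theorem proposition4p14 (k : fieldType) (k_char0 : [pchar k]%R =i pred0)
    (U : finGroupType -> Prop) (U_replete : replete U)
    (U_wide : widely_closed U) (unit_compact : compact (unit_cx k U)) :
  (forall G H : obj U,
     (forall X : cpt k U, pideal H X -> pideal G X) <->
     [set: G] \isog [set: H]) /\
  (exists p : pi0 U -> Spc k U,
     (forall (G : obj U) (X : cpt k U), p (pi0_class G) X <-> pideal G X) /\
     injective p).
Proof.
split=> [G H|].
  by split=> [/pideal_subset_isog|/isog_pideal GH X /GH]; first exact.
(* The map on classes is defined through chosen representatives; isomorphic groups give the same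
   ideal. *)
pose rep (C : pi0 U) : obj U := projT1 (cid (proj2_sig C)).
have repE (C : pi0 U) : sval C = obj_iso (rep C) by rewrite /rep; case: cid.
exists (fun C => SpcPoint (pideal_prime unit_compact (rep C))); split.
  move=> G X; apply: isog_pideal; rewrite isog_sym.
  rewrite -/(obj_iso G (rep (pi0_class G))).
  have /= -> := repE (pi0_class G); exact: isog_refl.
move=> C D /(congr1 (@spc_ideal k U)) /= eCD.
have iCD : obj_iso (rep C) (rep D).
  by apply: (pideal_subset_isog k_char0 unit_compact) => X; rewrite eCD.
(* Isomorphic representatives span the same class as a predicate, by extensionality; the
   accompanying existence proofs agree by proof irrelevance. *)
have {repE} : sval C = sval D.
  rewrite !repE; apply/predeqP => G; rewrite /obj_iso.
  by split; apply: isog_trans => //; rewrite isog_sym.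
case: C D {eCD iCD} => [C hC] [D hD] /= eCD; subst D.
by congr exist; apply: Prop_irrelevance.
Qed.
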